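(* Let $\mathfrak X\subset\mathbb R^n$ be a bounded domain. Let $A=\sum_{|\alpha|>0}\mathfrak a_\alpha(x)\partial_{x^\alpha}$ be an affine generator, $\mathfrak a_\alpha(x)=c_\alpha+x^\top d_\alpha$ with scalar $c_\alpha$ and $d_\alpha=(d_\alpha^{(1)},\dots,d_\alpha^{(n)})\in\mathbb R^n$, such that $\sum_{|\alpha|>0}\mathfrak a_\alpha(x)(\mathfrak iu)^\alpha$ converges absolutely for all $u\in\mathbb R^n$. Let $\widehat p(s,x,u)$ be the solution of $\partial_s\widehat p=A\widehat p$, $\widehat p(0,x,u)=e^{\mathfrak iu^\top x}$, $s\ge0$, $x\in\mathfrak X$. Assume that the system of ordinary differential equations $$\partial_sC=\sum_{|\alpha|>0}c_\alpha D^\alpha,\quad \partial_sD_j=\sum_{|\alpha|>0}d_\alpha^{(j)}D^\alpha,\ j=1,\dots,n,\qquad C(0,u)=0,\ D_j(0,u)=\mathfrak iu_j,$$ is non-exploding, i.e. its solution $(C(s,u),D(s,u))$ exists for all $0\le s<\infty$, and that for any fixed $u\in\mathbb R^n$ the solution $D(s,u)$ remains bounded as $s\to\infty$. Then for every $u\in\mathbb R^n$ there exists a radius $R_u>0$ such that for any $t\ge0$ (and $x\in\mathfrak X$) the map $s\mapsto\widehat p(t+s,x,u)$, $0\le s<R_u$, has a holomorphic extension to the disc $\{s\in\mathbb C:|s|<R_u\}$. Moreover, $$\widehat p(t+s,x,u)=\sum_{k=0}^\infty\frac{s^k}{k!}\,A^k\widehat p(t,\cdot,u)\,(x),\qquad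 |s|<R_u,\quad x\in\mathfrak X.$$
   Context: Multi-index notation: $\alpha\in\mathbb N_0^n$, $|\alpha|=\sum\alpha_i$, $D^\alpha=\prod_jD_j^{\alpha_j}$, $\partial_{x^\alpha}$ the corresponding partial derivative; $\mathfrak i$ is the imaginary unit. $A$ acts by $Af(x)=\sum_{|\alpha|>0}\mathfrak a_\alpha(x)\partial_{x^\alpha}f(x)$; this is the (formal) Taylor-expanded form of an integro-differential generator $\frac12\sum a_{ij}\partial_{ij}f+\sum b_i\partial_if+\int[f(x+z)-f(x)-\frac{\partial f}{\partial x}\cdot z]v(x,dz)$, regarded as a closed operator on $C(\mathfrak X)$ (continuous functions $\mathfrak X\to\mathbb C$ with the topology of uniform convergence on compacta). Standing assumption: the Cauchy problem $\partial_s\widehat p=A\widehat p$, $\widehat p(0,\cdot,u)=f_u$ on $\mathfrak X$ has a unique solution (on $[0,\infty)$; uniqueness holds on each interval $[0,T)$ and, likewise, from any initial time $t$). The solution of the ODE system is related to it by the ansatz $\widehat p(s,x,u)=\exp(C(s,u)+x^\top D(s,u))$. The functions $C$ and $D_j$ are complex valued. *)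

(* Defs.v *)
(* MathComp-Analysis over an arbitrary [R : realType], with C = [R[i]]. *)
From HB Require Import structures.
From mathcomp Require Import all_boot all_order all_algebra finmap complex.
From mathcomp Require Import all_classical all_reals all_analysis.
From mathcomp.analysis.showcase Require summability.

Set Implicit Arguments.
Unset Strict Implicit.
Unset Printing Implicit Defensive.

Import Order.TTheory GRing.Theory Num.Theory numFieldNormedType.Exports.

Local Open Scope classical_set_scope.
Local Open Scope complex_scope.
Local Open Scope ring_scope.

(* The library puts a topology on [R[i]] through its regular-module alias. *)
Notation Cplx R := (R[i])^o.

(* Complex-valued functions on R^n with uniform convergence on the compact
   subsets of X. This does not separate functions that agree on X, so it plays
   the role of a topology on functions X -> C; values outside X are junk. *)
Notation funC R n X := {family compactly_in (X : set 'rV[R]_n), 'rV[R]_n -> Cplx R}.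

(* The library only equips this alias with its uniform structure. *)
HB.instance Definition _ (K : numFieldType) (U : choiceType)
    (V : normedModType K) (fam : set U -> Prop) :=
  GRing.Lmodule.copy {family fam, U -> V} (U -> V).

Definition bounded_domain (R : realType) (n : nat) (X : set 'rV[R]_n) : Prop :=
  [/\ open X, connected X, X !=set0 & bounded_set X].

Definition mindex (n : nat) := {ffun 'I_n -> nat}.

Definition mdeg (n : nat) (al : mindex n) : nat := (\sum_i al i)%N.

Definition mpow (R : realType) (n : nat) (z : 'I_n -> R[i]) (al : mindex n) : R[i] :=
  \prod_i z i ^+ al i.

Definition dot (R : realType) (n : nat) (x y : 'rV[R]_n) : R :=
  \sum_i x 0 i * y 0 i.

(* Unordered sum over |al| > 0: the net of partial sums over finite sets of
   multi-indices converges. In C this is the same as absolute convergence. *)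
Definition is_msum (R : realType) (n : nat) (V : PreTopologicalLmodule.type R[i])
    (a : mindex n -> V) (v : V) : Prop :=
  \sum_(al <- enum_fset J | (0 < mdeg al)%N) a al
    @[J --> @summability.totally (mindex n)] --> v.

(* Derivative along the real parameter, relative to I (so one-sided at an
   endpoint of I that belongs to I). *)
Definition is_derive_in (R : realType) (V : PreTopologicalLmodule.type R[i])
    (I : set R) (f : R -> V) (s : R) (v : V) : Prop :=
  (h%:C)^-1 *: (f (s + h) - f s)
    @[h --> within [set h | I (s + h)] (0 : R)^'] --> v.

Definition pderiv (R : realType) (n : nat) (j : 'I_n) (f : 'rV[R]_n -> Cplx R)
    : 'rV[R]_n -> Cplx R :=
  let e : 'rV[R]_n := delta_mx 0 j in
  fun x => 'D_e (fun y => complex.Re (f y) : R^o) x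
             +i* 'D_e (fun y => complex.Im (f y) : R^o) x.

Definition mderiv (R : realType) (n : nat) (al : mindex n)
    (f : 'rV[R]_n -> Cplx R) : 'rV[R]_n -> Cplx R :=
  foldr (fun j g => iter (al j) (pderiv j) g) f (enum 'I_n).

(* C^infty on the open set X: along every word of coordinate directions the
   iterated partial derivatives exist and are continuous. *)
Definition smooth (R : realType) (n : nat) (X : set 'rV[R]_n)
    (f : 'rV[R]_n -> Cplx R) : Prop :=
  forall w : seq 'I_n,
    let g := foldr (@pderiv R n) f w in
    {within X, continuous g} /\
    forall (j : 'I_n) (x : 'rV[R]_n), X x ->
      derivable (fun y => complex.Re (g y) : R^o) x (delta_mx 0 j) /\
      derivable (fun y => complex.Im (g y) : R^o) x (delta_mx 0 j).

(* An operator on C(X) is given by its graph. *)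
Definition operator (R : realType) (n : nat) (X : set 'rV[R]_n) :=
  set (funC R n X * funC R n X).

Definition closed_operator (R : realType) (n : nat) (X : set 'rV[R]_n)
    (A : operator X) : Prop :=
  [/\ forall f g, A (f, g) ->
        {within X, continuous f} /\ {within X, continuous g},
      A 0 /\ forall (z : R[i]) v w, A v -> A w -> A (z *: v + w),
      forall f g h, A (f, g) -> A (f, h) -> {in X, g =1 h} &
      closed A].

Fixpoint op_pow (R : realType) (n : nat) (X : set 'rV[R]_n) (A : operator X)
    (k : nat) (f g : funC R n X) : Prop :=
  if k is k'.+1 then exists2 h, op_pow A k' f h & A (h, g)
  else {in X, f =1 g}.

Definition affine_coef (R : realType) (n : nat) (c : mindex n -> R)
    (d : mindex n -> 'rV[R]_n) (al : mindex n) (x : 'rV[R]_n) : R :=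
  c al + dot x (d al).

(* A f = \sum_(|al| > 0) a_al d_al f whenever f is smooth and the series
   converges in C(X). Being closed, A may have a larger domain. *)
Definition acts_as_series (R : realType) (n : nat) (X : set 'rV[R]_n)
    (A : operator X) (a : mindex n -> 'rV[R]_n -> R) : Prop :=
  forall f g : funC R n X, smooth X f ->
    is_msum (R := R) (V := funC R n X) (fun al x => (a al x)%:C * mderiv al f x) g ->
    A (f, g).

Definition symbol_abs_cvg (R : realType) (n : nat) (X : set 'rV[R]_n)
    (a : mindex n -> 'rV[R]_n -> R) : Prop :=
  forall x, X x -> forall u : 'rV[R]_n,
    summable [set al | (0 < mdeg al)%N] (fun al =>
      (ComplexField.Normc.normc
        ((a al x)%:C * mpow (fun j => 'i * (u 0 j)%:C) al))%:E).

Definition evolves_on (R : realType) (n : nat) (X : set 'rV[R]_n)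
    (A : operator X) (I : set R) (p : R -> funC R n X) : Prop :=
  forall s, I s -> exists2 g, A (p s, g) & is_derive_in (R := R) (V := funC R n X) I p s g.

(* p is the unique solution of p' = A p, p(0) = f; uniqueness is understood on
   every [t, T[, for the problem started from p(t) at time t. *)
Definition unique_solution (R : realType) (n : nat) (X : set 'rV[R]_n)
    (A : operator X) (f : 'rV[R]_n -> Cplx R) (p : R -> funC R n X) : Prop :=
  [/\ evolves_on A `[0, +oo[ p,
      {in X, p 0 =1 f} &
      forall (t T : R) (q : R -> funC R n X), 0 <= t -> t < T ->
        evolves_on A `[t, T[ q -> {in X, q t =1 p t} ->
        forall s, t <= s < T -> {in X, q s =1 p s}].

Definition expi (R : realType) (n : nat) (u : 'rV[R]_n) (x : 'rV[R]_n) : Cplx R :=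
  cos (dot u x) +i* sin (dot u x).

Definition ode_solution (R : realType) (n : nat) (c : mindex n -> R)
    (d : mindex n -> 'rV[R]_n) (u : 'rV[R]_n)
    (C : R -> Cplx R) (D : R -> 'I_n -> Cplx R) : Prop :=
  [/\ C 0 = 0,
      forall j, D 0 j = 'i * (u 0 j)%:C,
      forall s, 0 <= s -> exists2 v : Cplx R,
        is_msum (R := R) (V := (Cplx R : tvsType R[i])) (fun al => (c al)%:C * mpow (D s) al) v &
        is_derive_in (R := R) (V := (Cplx R : tvsType R[i])) `[0, +oo[ C s v &
      forall j s, 0 <= s -> exists2 v : Cplx R,
        is_msum (R := R) (V := (Cplx R : tvsType R[i])) (fun al => (d al 0 j)%:C * mpow (D s) al) v &
        is_derive_in (R := R) (V := (Cplx R : tvsType R[i])) `[0, +oo[ (D ^~ j) s v].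

(* Main.v *)
Require Import Defs.
From HB Require Import structures.
From mathcomp Require Import all_boot all_order all_algebra complex finmap.
From mathcomp Require Import all_classical all_reals all_analysis.
From mathcomp.analysis.showcase Require summability.
From mathcomp Require Import ring lra.

Set Implicit Arguments.
Unset Strict Implicit.
Unset Printing Implicit Defensive.

Import Order.TTheory GRing.Theory Num.Theory numFieldNormedType.Exports.

Local Open Scope classical_set_scope.
Local Open Scope complex_scope.
Local Open Scope ring_scope.

(* The function exp (C(s) + x^T D(s)) solves the Cauchy problem, so by uniqueness it is
   p(s, x, u) on X. The right-hand sides of the ODE system are entire and D is bounded, so
   the Taylor coefficients of D at time s, which are computed recursively from D(s), satisfy
   |D_k(s)| <= const / r^k with r independent of s: in the submultiplicative norm
   sum_k |a_k| r^k on truncated series the recursion maps the ball of radius M + 1 to itself.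
   Hence the Taylor coefficients of exp (C + x^T D) in s are bounded by const(s) / r^k
   uniformly on X, its Taylor series converges to it, and because A is closed, k! times the
   k-th coefficient at time t is A^k p(t, ., u). *)

(** All estimates are made at real times, on sequences of coefficients; no differential equation is
    solved in complex time and no Cauchy integral is used. The coefficients come from formal
    recursions, and the fact that they are the derivatives of the actual curves is proved
    separately, by differentiating those recursions in the base point [s]: this works because the
    ODE system is autonomous. The extra [1] in the radius [M + 1] is the room in which a jet may
    move away from [D(s)], and [r] is chosen so small that it uses at most this room. Only [D]
    enters the nonlinear right-hand sides. [C] may grow with time, but it changes only the constant
    in front of the bound, which is why one radius serves every [t]. Boundedness of [X] turns bounds
    on [C] and [D] into bounds uniform in [x], as convergence in [funC R n X] demands. For [k > 0]
    the coefficients of the wave are no longer pure exponentials in [x], so the series of [A] is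
    evaluated only on exponentials; higher powers of [A] come from time derivatives. *)

Notation normc := ComplexField.Normc.normc.

(** * Real-valued modulus and limits in [R[i]] *)

Section ComplexNorm.
Context {R : realType}.
Implicit Types z w : R[i].

Lemma normc_norm (z : Cplx R) : `|z| = (normc z)%:C.
Proof. by []. Qed.

Lemma normc_ge0 z : 0 <= normc z.
Proof. by case: z => a b; exact: sqrtr_ge0. Qed.

Lemma normcD z w : normc (z + w) <= normc z + normc w.
Proof. exact: le_normcD. Qed.

Lemma normcB z w : normc (z - w) = normc (w - z).
Proof. by rewrite -opprB; exact: normcN. Qed.

Lemma normcMl z w : normc (z * w) = normc z * normc w.
Proof. exact: ComplexField.Normc.normcM. Qed.

Lemma normcR (x : R) : normc x%:C = `|x|.
Proof. by rewrite /= expr0n/= addr0 sqrtr_sqr. Qed.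

Lemma normc_nat (k : nat) : normc (k%:R : R[i]) = k%:R.
Proof. by rewrite -(rmorph_nat (real_complex R)) normcR ger0_norm. Qed.

Lemma normcX z k : normc (z ^+ k) = normc z ^+ k.
Proof.
elim: k => [|k IH]; first by rewrite !expr0 ComplexField.Normc.normc1.
by rewrite !exprS normcMl IH.
Qed.

Lemma normc_sum (I : Type) (s : seq I) (P : pred I) (f : I -> R[i]) :
  normc (\sum_(i <- s | P i) f i) <= \sum_(i <- s | P i) normc (f i).
Proof.
elim/big_ind2 : _ => //; first by rewrite ComplexField.Normc.normc0.
by move=> a x b y ax yb; apply: (le_trans (normcD _ _)); apply: lerD.
Qed.

Lemma normc_Re z : `|complex.Re z| <= normc z.
Proof.
case: z => a b /=; rewrite -sqrtr_sqr ler_sqrt ?lerDl ?sqr_ge0//.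
by rewrite addr_ge0 ?sqr_ge0.
Qed.

Lemma normc_Im z : `|complex.Im z| <= normc z.
Proof.
case: z => a b /=; rewrite -sqrtr_sqr ler_sqrt ?lerDr ?sqr_ge0//.
by rewrite addr_ge0 ?sqr_ge0.
Qed.

Lemma normc_ReIm z : normc z <= `|complex.Re z| + `|complex.Im z|.
Proof.
case: z => a b /=; rewrite -[leRHS]ger0_norm ?addr_ge0// -sqrtr_sqr ler_sqrt ?sqr_ge0//.
by rewrite sqrrD !real_normK ?num_real// lerD2r lerDl mulrn_wge0// mulr_ge0.
Qed.

Lemma normc_lt (z : Cplx R) (x : R) : (`|z| < x%:C) = (normc z < x).
Proof. by rewrite normc_norm ltcR. Qed.

Lemma normc_le (z : Cplx R) (x : R) : (`|z| <= x%:C) = (normc z <= x).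
Proof. by rewrite normc_norm lecR. Qed.

(** The norm of [Cplx R] takes values in [R[i]], so its epsilons are complex. A positive complex
    number is real, hence real epsilons suffice; all later limits go through this form. *)
Lemma cvg_normcP (T : Type) (F : set_system T) {FF : Filter F}
    (f : T -> Cplx R) (l : Cplx R) :
  f x @[x --> F] --> l <->
  forall e : R, 0 < e -> \forall x \near F, normc (f x - l) < e.
Proof.
rewrite cvgrPdist_lt; split=> H e e0.
  have e0' : 0 < e%:C by rewrite ltcR.
  by apply: filterS (H _ e0') => x; rewrite normc_lt normcB.
have e0' : 0 < complex.Re e by move: e0; rewrite ltcE => /andP[].
have -> : e = (complex.Re e)%:C by apply/esym/RRe_real/ger0_real/ltW.
by apply: filterS (H _ e0') => x; rewrite normc_lt normcB.
Qed.

Lemma cvg_normc (T : Type) (F : set_system T) {FF : Filter F}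
    (f : T -> Cplx R) (l : Cplx R) :
  f x @[x --> F] --> l -> normc (f x) @[x --> F] --> normc l.
Proof.
move=> /cvg_normcP fl; apply/cvgrPdist_lt => e /fl; apply: filterS => x.
apply: le_lt_trans; rewrite ler_norml.
have h1 := normcD (f x - l) l; have h2 := normcD (l - f x) (f x).
move: h1 h2; rewrite !subrK (normcB l) => h1 h2; apply/andP; split; lra.
Qed.

Lemma cvg_sub_normc (T : Type) (F : set_system T) {FF : Filter F}
    (f : T -> Cplx R) (l : Cplx R) (g : T -> R) :
  (\forall x \near F, normc (f x - l) <= g x) -> g x @[x --> F] --> 0 ->
  f x @[x --> F] --> l.
Proof.
move=> fg g0; apply/cvg_normcP => e e0.
move/cvgrPdist_lt : g0 => /(_ _ e0); apply: filterS2 fg => x.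
rewrite sub0r normrN => h; apply: le_lt_trans.
by apply: le_trans h _; exact: ler_norm.
Qed.

Lemma cvg_Re (T : Type) (F : set_system T) {FF : Filter F}
    (f : T -> Cplx R) (l : Cplx R) :
  f x @[x --> F] --> l -> complex.Re (f x) @[x --> F] --> complex.Re l.
Proof.
move=> /cvg_normcP fl; apply/cvgrPdist_lt => e /fl; apply: filterS => x.
by apply: le_lt_trans; rewrite distrC -raddfB; exact: normc_Re.
Qed.

Lemma cvg_Im (T : Type) (F : set_system T) {FF : Filter F}
    (f : T -> Cplx R) (l : Cplx R) :
  f x @[x --> F] --> l -> complex.Im (f x) @[x --> F] --> complex.Im l.
Proof.
move=> /cvg_normcP fl; apply/cvgrPdist_lt => e /fl; apply: filterS => x.
by apply: le_lt_trans; rewrite distrC -raddfB; exact: normc_Im.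
Qed.

Lemma cvg_ReIm (T : Type) (F : set_system T) {FF : Filter F}
    (f : T -> Cplx R) (a b : R) :
  complex.Re (f x) @[x --> F] --> a -> complex.Im (f x) @[x --> F] --> b ->
  f x @[x --> F] --> (a +i* b : Cplx R).
Proof.
move=> fa fb.
apply: (@cvg_sub_normc _ _ _ _ _ (fun x => `|complex.Re (f x) - a| + `|complex.Im (f x) - b|)).
  apply: nearW => x; apply: le_trans (normc_ReIm _) _.
  by rewrite !raddfB.
rewrite -[X in _ --> X]addr0; apply: cvgD.
  by apply/norm_cvg0P; apply/subr_cvg0.
by apply/norm_cvg0P; apply/subr_cvg0.
Qed.

Lemma cvgC_add (T : Type) (F : set_system T) {FF : Filter F} (f g : T -> Cplx R) (a b : Cplx R) :
  f x @[x --> F] --> a -> g x @[x --> F] --> b -> f x + g x @[x --> F] --> (a + b : Cplx R).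
Proof. exact: cvgD. Qed.

Lemma cvgC_mul (T : Type) (F : set_system T) {FF : Filter F} (f g : T -> Cplx R) (a b : Cplx R) :
  f x @[x --> F] --> a -> g x @[x --> F] --> b -> f x * g x @[x --> F] --> (a * b : Cplx R).
Proof. exact: cvgM. Qed.

Lemma cvgC_cst (T : Type) (F : set_system T) {FF : Filter F} (a : Cplx R) :
  a @[x --> F] --> a.
Proof. exact: cvg_cst. Qed.
End ComplexNorm.
Arguments cvgC_cst {R T F FF} a.

Lemma cvg_eq1 (T : Type) (U : topologicalType) (F : set_system T) (f g : T -> U) (l : U) :
  f =1 g -> f x @[x --> F] --> l -> g x @[x --> F] --> l.
Proof. by move=> /funext ->. Qed.

Notation usum a J := (\sum_(i <- enum_fset J) a i).
Notation totally := summability.totally.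
#[global] Existing Instance summability.totally_filter.

(** * Unordered sums and dominated convergence *)

Section UnorderedSums.
Context {R : realType} {I : choiceType}.
Implicit Types (a b : I -> Cplx R) (m : I -> R) (J : {fset I}).

Definition sums a (v : Cplx R) := usum a J @[J --> @totally I] --> v.

Definition majorant m (B : R) :=
  (forall i, 0 <= m i) /\ forall J, usum m J <= B.

Lemma totally_ge (J0 : {fset I}) : \forall J \near @totally I, (J0 `<=` J)%fset.
Proof. by exists J0. Qed.

Lemma usum_sub (V : zmodType) (f : I -> V) (J0 J : {fset I}) :
  (J0 `<=` J)%fset -> usum f J - usum f J0 = usum f (J `\` J0)%fset.
Proof.
move=> J0J; rewrite (big_fsetID _ (mem J0))/= addrC.
have -> : [fset x | x in J & x \in J0]%fset = J0.
  apply/fsetP => x; rewrite !inE/=; case: (boolP (x \in J0)); rewrite ?andbF// andbT.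
  by move/(fsubsetP J0J).
rewrite addrK; congr (\sum_(i <- enum_fset _) _).
by apply/fsetP => x; rewrite !inE/= andbC.
Qed.

(** The supremum of the finite sums is approached within [e] by some [J0]; a larger finite set can
    gain no more than that. *)
Lemma majorant_tail m B : majorant m B -> forall e : R, 0 < e ->
  exists J0, forall J, (J0 `<=` J)%fset -> usum m J - usum m J0 <= e.
Proof.
move=> [m0 mB] e e0; pose S : set R := range (fun J => usum m J).
have hS : has_sup S.
  by split; [exists (usum m fset0), fset0|exists B => _ [J _ <-]].
have [_ [J0 _ <-] hJ0] := sup_adherent e0 hS.
exists J0 => J _; rewrite lerBlDl.
have : usum m J <= sup S by apply: ub_le_sup; [case: hS|exists J].
by move: hJ0; lra.
Qed.

Lemma normc_usum_sub a m (J0 J : {fset I}) : (forall i, normc (a i) <= m i) ->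
  (J0 `<=` J)%fset -> normc (usum a J - usum a J0) <= usum m J - usum m J0.
Proof.
move=> am J0J; rewrite !usum_sub//; apply: le_trans (normc_sum _ _ _) _.
exact: ler_sum.
Qed.


Lemma normc_cvg_le (T : Type) (F : set_system T) {FF : ProperFilter F}
    (f : T -> Cplx R) (l : Cplx R) (B : R) :
  f x @[x --> F] --> l -> (\forall x \near F, normc (f x) <= B) -> normc l <= B.
Proof. by move=> /cvg_normc; exact: cvgr_to_le. Qed.

Lemma sums_tail a m v (J0 : {fset I}) (e : R) :
  (forall i, normc (a i) <= m i) ->
  (forall J, (J0 `<=` J)%fset -> usum m J - usum m J0 <= e) ->
  sums a v -> normc (v - usum a J0) <= e.
Proof.
move=> am tl av; apply: (@normc_cvg_le _ (@totally I) _ (fun J => usum a J - usum a J0)).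
  exact: cvgC_add av (cvgC_cst (- usum a J0)).
apply: filterS (totally_ge J0) => J J0J.
exact: le_trans (normc_usum_sub am J0J) (tl _ J0J).
Qed.

Lemma sums_unique a v w : sums a v -> sums a w -> v = w.
Proof. by move=> av aw; apply: (cvg_unique _ av aw); exact: norm_hausdorff. Qed.

Lemma majorant_cvg m B : majorant m B ->
  exists l : R, usum m J @[J --> @totally I] --> l.
Proof.
move=> mB; have [m0 mB'] := mB.
pose S : set R := range (fun J => usum m J).
have uS : has_ubound S by exists B => _ [J _ <-].
exists (sup S); apply/cvgrPdist_le => e /(majorant_tail mB) [J0 hJ0].
have SJ J : usum m J <= sup S by apply: ub_le_sup => //; exists J.
have mono J J' : (J `<=` J')%fset -> usum m J <= usum m J'.
  by move=> JJ; rewrite -subr_ge0 usum_sub// sumr_ge0.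
apply: filterS (totally_ge J0) => J J0J; rewrite ger0_norm ?subr_ge0//.
rewrite lerBlDl; apply: sup_le_ub; first by exists (usum m J), J.
move=> _ [J' _ <-]; have := hJ0 _ (fsubsetUl J0 J'); have := mono _ _ J0J.
have := mono _ _ (fsubsetUr J0 J'); lra.
Qed.

(** [f] is the difference of [f + m] and [m], both nonnegative with bounded finite sums. *)
Lemma majorized_cvg (f m : I -> R) B : (forall i, `|f i| <= m i) -> majorant m B ->
  exists l : R, usum f J @[J --> @totally I] --> l.
Proof.
move=> fm mB; have [l hl] := majorant_cvg mB.
have [|l' hl'] := @majorant_cvg (fun i => f i + m i) (B + B).
  split=> [i|J]; first by have := fm i; rewrite ler_norml => /andP[]; lra.
  rewrite big_split/=; apply: lerD; last exact: mB.2.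
  by apply: le_trans (mB.2 J); apply: ler_sum => i _; apply: le_trans (fm i); exact: ler_norm.
exists (l' - l); apply: cvg_eq1 (cvgB hl' hl) => J /=.
by rewrite big_split/= addrK.
Qed.

Lemma majorized_sums a m B : (forall i, normc (a i) <= m i) -> majorant m B ->
  exists v, sums a v.
Proof.
move=> am mB.
have [x hx] : exists l : R, usum (fun i => complex.Re (a i)) J @[J --> @totally I] --> l.
  by apply: majorized_cvg mB => i; exact: le_trans (normc_Re _) (am i).
have [y hy] : exists l : R, usum (fun i => complex.Im (a i)) J @[J --> @totally I] --> l.
  by apply: majorized_cvg mB => i; exact: le_trans (normc_Im _) (am i).
exists (x +i* y); apply: cvg_ReIm.
  by apply: cvg_eq1 hx => J; rewrite raddf_sum.
by apply: cvg_eq1 hy => J; rewrite raddf_sum.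
Qed.

Lemma sumsD a b v w : sums a v -> sums b w -> sums (fun i => a i + b i) (v + w).
Proof.
move=> av bw; apply: cvg_eq1 (cvgD av bw) => J /=.
by rewrite big_split.
Qed.

Lemma sumsZ a v (k : R[i]) : sums a v -> sums (fun i => k * a i) (k * v).
Proof.
move=> av; apply: cvg_eq1 (cvgM (cvg_cst (k : Cplx R)) av) => J.
by rewrite /= mulr_sumr.
Qed.

(** Dominated convergence along any filter: one finite set [J0] makes the tails of all [f h] and of
    [g] at most [e / 4], and on [J0] only a finite sum has to converge. *)
Lemma sums_dominated (T : Type) (F : set_system T) {FF : Filter F}
    (f : T -> I -> Cplx R) (g : I -> Cplx R) m B (v : T -> Cplx R) (w : Cplx R) :
  majorant m B ->
  (\forall h \near F, forall i, normc (f h i) <= m i) ->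
  (forall i, normc (g i) <= m i) ->
  (forall i, f h i @[h --> F] --> g i) ->
  (\forall h \near F, sums (f h) (v h)) -> sums g w ->
  v h @[h --> F] --> w.
Proof.
move=> mB fm gm fg fv gw; apply/cvg_normcP => e e0.
have e4 : 0 < e / 4 by rewrite divr_gt0.
have [J0 hJ0] := majorant_tail mB e4.
have : usum (f h) J0 @[h --> F] --> usum g J0.
  by apply: cvg_big => [|i _]; [exact: add_continuous|exact: fg].
move/cvg_normcP => /(_ _ e4).
apply: filterS3 fm fv => h fm fv.
have t1 := sums_tail fm hJ0 fv; have t2 := sums_tail gm hJ0 gw.
move=> t3.
have -> : v h - w = (v h - usum (f h) J0) + (usum (f h) J0 - usum g J0) - (w - usum g J0).
  by ring.
apply: le_lt_trans (normcD _ _) _; apply: le_lt_trans (lerD (normcD _ _) (lexx _)) _.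
rewrite (_ : normc (- _) = normc (w - usum g J0)); last exact: normcN.
move: t1 t2 t3; lra.
Qed.
End UnorderedSums.

(** * Derivatives on the half-line and the mean value inequality *)

Section Derivative.
Context {R : realType}.
Implicit Types (f g : R -> Cplx R) (s h : R).

(* The filter of [is_derive_in `[0, +oo[] at [s]. *)
Definition incr s : set_system R := within [set h | `[0, +oo[%classic (s + h)] (0 : R)^'.

#[global] Instance incr_filter s : Filter (incr s).
Proof. exact: within_filter. Qed.

#[local] Hint Extern 0 (Filter (incr _)) => exact: incr_filter : typeclass_instances.

Definition der f g := forall s, 0 <= s ->
  is_derive_in (R := R) (V := (Cplx R : tvsType R[i])) `[0, +oo[ f s (g s).


Lemma incrP s (P : set R) : (\forall h \near incr s, P h) <->
  exists2 e : R, 0 < e & forall h, `|h| < e -> h != 0 -> 0 <= s + h -> P h.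
Proof.
split.
  move=> /nbhs_ballP[e/= e0 H]; exists e => // h he h0 sh.
  by apply: H => //=; [rewrite /ball/= sub0r normrN|rewrite in_itv/= andbT].
move=> [e e0 H]; apply/nbhs_ballP; exists e => //= h.
rewrite /ball/= sub0r normrN => he h0; rewrite in_itv/= andbT => sh.
exact: H.
Qed.

Lemma near_incr s : \forall h \near incr s, h != 0 /\ 0 <= s + h.
Proof. by apply/incrP; exists 1. Qed.

Lemma incr_small s (e : R) : 0 < e -> \forall h \near incr s, `|h| < e.
Proof. by move=> e0; apply/incrP; exists e. Qed.

Lemma incr_proper s : 0 <= s -> ProperFilter (incr s).
Proof.
move=> s0; apply: Build_ProperFilter_ex => P /incrP[e e0 H].
have e2 : 0 < e / 2 by rewrite divr_gt0.
exists (e / 2); apply: H; [rewrite gtr0_norm//; lra|by rewrite gt_eqF|lra].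
Qed.

Lemma derP f (v : Cplx R) s :
  is_derive_in (R := R) (V := (Cplx R : tvsType R[i])) `[0, +oo[ f s v <->
  ((h%:C)^-1 : Cplx R) * (f (s + h) - f s) @[h --> incr s] --> v.
Proof. by []. Qed.

Lemma cvg_incr_id s : h%:C @[h --> incr s] --> (0 : Cplx R).
Proof.
apply/cvg_normcP => e /(incr_small s); apply: filterS => h.
by rewrite subr0 normcR.
Qed.

Lemma near_cvg_eq (T : Type) (F : set_system T) {FF : Filter F} (u w : T -> Cplx R) (l : Cplx R) :
  (\forall x \near F, u x = w x) -> u x @[x --> F] --> l -> w x @[x --> F] --> l.
Proof.
move=> uw ul; apply: cvg_trans ul => P /= lP.
by apply: filterS2 uw lP => x; rewrite /preimage/= => ->.
Qed.

Lemma is_der_cvg f (v : Cplx R) s :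
  ((h%:C)^-1 : Cplx R) * (f (s + h) - f s) @[h --> incr s] --> v ->
  f (s + h) @[h --> incr s] --> f s.
Proof.
move=> fv; have -> : f s = 0 * v + f s by rewrite mul0r add0r.
apply: near_cvg_eq (cvgC_add (cvgC_mul (cvg_incr_id s) fv) (cvgC_cst (f s))); near=> h.
have h0 : h%:C != 0 :> R[i].
  by rewrite (inj_eq (@complexI R) h 0); near: h; apply: filterS (near_incr s) => h [].
by rewrite /= mulrA divff// mul1r subrK.
Unshelve. all: by end_near. Qed.

Lemma der_ext f f' g g' : {in >= 0, f =1 f'} -> {in >= 0, g =1 g'} -> der f g -> der f' g'.
Proof.
move=> ff gg fg s s0; have := fg _ s0; rewrite !derP -gg//.
move=> H; apply: near_cvg_eq H; apply: filterS (near_incr s) => h [_ sh].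
by rewrite !ff.
Qed.

Lemma der_cst (v : Cplx R) : der (fun=> v) (fun=> 0).
Proof.
move=> s s0; apply/derP; under eq_fun do rewrite subrr mulr0.
exact: cvgC_cst.
Qed.

Lemma derD f f' g g' : der f f' -> der g g' ->
  der (fun s => f s + g s) (fun s => f' s + g' s).
Proof.
move=> ff gg s s0; apply/derP.
apply: cvg_eq1 (cvgC_add ((derP _ _ _).1 (ff _ s0)) ((derP _ _ _).1 (gg _ s0))) => h /=.
by rewrite -mulrDr; congr (_ * _); ring.
Qed.

Lemma derM f f' g g' : der f f' -> der g g' ->
  der (fun s => f s * g s) (fun s => f' s * g s + f s * g' s).
Proof.
move=> ff gg s s0; apply/derP.
have f1 := (derP _ _ _).1 (ff _ s0); have g1 := (derP _ _ _).1 (gg _ s0).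
apply: cvg_eq1 (cvgC_add (cvgC_mul f1 (is_der_cvg g1)) (cvgC_mul (cvgC_cst (f s)) g1)) => h /=.
ring.
Qed.

Lemma derZ (k : Cplx R) f f' : der f f' -> der (fun s => k * f s) (fun s => k * f' s).
Proof.
move=> ff; apply: der_ext (derM (der_cst k) ff) => // s _.
by rewrite mul0r add0r.
Qed.

Lemma der_sum (I : Type) (r : seq I) (P : pred I) (f f' : I -> R -> Cplx R) :
  (forall i, P i -> der (f i) (f' i)) ->
  der (fun s => \sum_(i <- r | P i) f i s) (fun s => \sum_(i <- r | P i) f' i s).
Proof.
move=> ff; elim: r => [|i r IH].
  by apply: der_ext (der_cst 0) => s _; rewrite big_nil.
case: (boolP (P i)) => Pi.
  by apply: der_ext (derD (ff _ Pi) IH) => s _; rewrite big_cons Pi.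
by apply: der_ext IH => s _; rewrite big_cons (negbTE Pi).
Qed.

Lemma der_continuous f g s : der f g -> 0 <= s -> f (s + h) @[h --> incr s] --> f s.
Proof. by move=> fg s0; apply: is_der_cvg; apply/derP; exact: fg. Qed.

(* [pr] is the real or the imaginary part. *)
Section MeanValue.
Variables (pr : Cplx R -> R).
Hypothesis prB : forall z w, pr (z - w) = pr z - pr w.
Hypothesis prZ : forall (x : R) z, pr (x%:C * z) = x * pr z.
Hypothesis pr_le : forall z, `|pr z| <= normc z.

Lemma pr_cvg (T : Type) (F : set_system T) {FF : Filter F} (u : T -> Cplx R) (l : Cplx R) :
  u x @[x --> F] --> l -> pr (u x) @[x --> F] --> pr l.
Proof.
move=> /cvg_normcP ul; apply/cvgrPdist_lt => e /ul; apply: filterS => x.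
by apply: le_lt_trans; rewrite distrC -prB.
Qed.

Lemma der_pr_le f g (a b B : R) : der f g -> 0 <= a -> a < b ->
  (forall s, a <= s <= b -> normc (g s) <= B) ->
  `|pr (f b) - pr (f a)| <= B * (b - a).
Proof.
move=> fg a0 ab gB.
have cf s : 0 <= s -> forall e, 0 < e -> exists2 d, 0 < d &
    forall t, 0 <= t -> `|t - s| < d -> `|pr (f s) - pr (f t)| < e.
  move=> s0 e e0; have /pr_cvg := der_continuous fg s0.
  move=> /cvgrPdist_lt/(_ _ e0)/incrP[d d0 H]; exists d => // t t0 td.
  have [->|ts] := eqVneq t s; first by rewrite subrr normr0.
  by have := H (t - s) td; rewrite subr_eq0 addrC subrK; exact.
have [| |c] := @MVT R (fun s => pr (f s)) (fun s => pr (g s)) a b ab.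
- move=> s; rewrite in_itv/= => /andP[as' sb].
  have s0 : 0 < s by exact: le_lt_trans as'.
  have H : (h^-1 * (pr (f (s + h)) - pr (f s))) @[h --> (0:R)^'] --> pr (g s).
    have /derP/pr_cvg := fg _ (ltW s0).
    move=> /cvgrPdist_lt H; apply/cvgrPdist_lt => e /H/incrP[d d0 {}H].
    (* Increments smaller than [s] keep [s + h] nonnegative, so at an interior point the derivative
       relative to the half-line is the two-sided one that [MVT] expects. *)
    apply/nbhs_ballP; exists (Num.min d s) => /=; first by rewrite lt_min d0.
    move=> h; rewrite /ball/= sub0r normrN lt_min => /andP[hd hs] h0.
    rewrite -prB -prZ fmorphV; apply: H => //.
    by move: hs; rewrite ltr_norml => /andP[]; lra.
  have H' : h^-1 *: ((pr \o f \o shift s) (h *: 1) - (pr \o f) s) @[h --> (0:R)^'] --> pr (g s).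
    apply: cvg_eq1 H => h /=.
    by rewrite [h *: 1]mulr1 (addrC h).
  by split; [exact: cvgP H'|exact: cvg_lim H'].
- apply/continuous_within_itvP => //; split.
  + move=> s; rewrite in_itv/= => /andP[as' _].
    have s0 : 0 < s by exact: le_lt_trans as'.
    apply/cvgrPdist_lt => e e0; have [d d0 H] := cf s (ltW s0) e e0.
    apply/nbhs_ballP; exists (Num.min d s) => /=; first by rewrite lt_min d0.
    move=> t; rewrite /ball/= lt_min distrC => /andP[td ts]; apply: H => //.
    by move: ts; rewrite ltr_norml => /andP[]; lra.
  + apply/cvgrPdist_lt => e e0; have [d d0 H] := cf a a0 e e0.
    apply/nbhs_ballP; exists d => //= t; rewrite /ball/= distrC => td at'.
    by apply: H => //; rewrite (le_trans a0)// ltW.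
  + have b0 := le_lt_trans a0 ab.
    apply/cvgrPdist_lt => e e0; have [d d0 H] := cf b (ltW b0) e e0.
    apply/nbhs_ballP; exists (Num.min d b) => /=; first by rewrite lt_min d0.
    move=> t; rewrite /ball/= lt_min distrC => /andP[td ts] _; apply: H => //.
    by move: ts; rewrite ltr_norml => /andP[]; lra.
- rewrite in_itv/= => /andP[ac cb] ->.
  rewrite normrM (@gtr0_norm _ (b - a)) ?subr_gt0//; apply: ler_wpM2r.
    by rewrite subr_ge0 ltW.
  by apply: le_trans (pr_le _) _; apply: gB; rewrite !ltW.
Qed.
End MeanValue.

(** The mean value theorem holds for real functions only; it is applied to the real and imaginary
    parts, and adding the two bounds produces the factor 2. *)
Lemma der_le f g (a b B : R) : der f g -> 0 <= a -> a <= b ->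
  (forall s, a <= s <= b -> normc (g s) <= B) ->
  normc (f b - f a) <= 2 * B * (b - a).
Proof.
move=> fg a0; rewrite le_eqVlt => /predU1P[->|ab] gB.
  by rewrite !subrr ComplexField.Normc.normc0 mulr0.
have sc (pr : R[i] -> R) : (pr = @complex.Re R \/ pr = @complex.Im R) ->
    `|pr (f b) - pr (f a)| <= B * (b - a).
  case=> ->; apply: (@der_pr_le _ _ _ _ f g a b B fg a0 ab gB) => //;
    try exact: normc_Re; try exact: normc_Im; try (by move=> z w; rewrite raddfB);
    by move=> x [u v] /=; rewrite !mul0r ?subr0 ?addr0.
apply: le_trans (normc_ReIm _) _; rewrite !raddfB/=.
have := sc _ (or_introl erefl); have := sc _ (or_intror erefl); lra.
Qed.

Lemma der_le_norm f g (a b B : R) : der f g -> 0 <= a -> 0 <= b ->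
  (forall s, Num.min a b <= s <= Num.max a b -> normc (g s) <= B) ->
  normc (f b - f a) <= 2 * B * `|b - a|.
Proof.
move=> fg a0 b0; have [ab|ba] := leP a b => gB.
  by rewrite ger0_norm ?subr_ge0//; exact: (@der_le _ g).
rewrite normcB distrC gtr0_norm ?subr_gt0//.
by apply: (@der_le _ g) => //; exact: ltW.
Qed.
End Derivative.

(** * Complex exponential *)

Section ComplexExponential.
Context {R : realType}.

Definition cexp (z : Cplx R) : Cplx R :=
  (expR (complex.Re z))%:C * (cos (complex.Im z) +i* sin (complex.Im z)).

Lemma cexpD z w : cexp (z + w) = cexp z * cexp w.
Proof.
case: z => a b; case: w => a' b'; rewrite /cexp/= expRD cosD sinD.
by apply/eqP; rewrite eq_complex/=; apply/andP; split; apply/eqP; ring.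
Qed.

Lemma normc_cexp z : normc (cexp z) = expR (complex.Re z).
Proof.
rewrite /cexp normcMl normcR ger0_norm ?expR_ge0//=.
by rewrite cos2Dsin2 sqrtr1 mulr1.
Qed.

Lemma is_derive_taylor1 (f : R -> R) (df : R) : is_derive (0 : R) 1 f df ->
  forall e : R, 0 < e -> exists2 d : R, 0 < d &
    forall x, `|x| < d -> `|f x - f 0 - df * x| <= e * `|x|.
Proof.
case=> + <- e e0; rewrite /derivable /derive => /cvg_ex[l /[dup]/cvg_lim -> //].
move=> /cvgrPdist_le/(_ _ e0) /nbhs_ballP[d/= d0 H]; exists d => // x xd.
have [->|x0] := eqVneq x 0; first by rewrite mulr0 subrr subr0 !normr0 mulr0.
have := H x; rewrite /ball/= sub0r normrN => /(_ xd x0).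
rewrite addr0 [x *: 1]mulr1 [_ *: _]mulrC distrC => h.
have -> : f x - f 0 - l * x = ((f x - f 0) / x - l) * x by field.
by rewrite normrM ler_wpM2r.
Qed.

Lemma cexp_taylor1 (e : R) : 0 < e -> exists2 d : R, 0 < d &
  forall w, normc w < d -> normc (cexp w - 1 - w) <= e * normc w.
Proof.
(* Three errors of size [e / 7] arise in the real part and four in the imaginary part, where the
   product [a * b] is the additional one. *)
move=> e0; have e7 : 0 < e / 7 by rewrite divr_gt0.
have [d1 d10 h1] := is_derive_taylor1 (is_derive_expR 0) e7.
have [d2 d20 h2] := is_derive_taylor1 (is_derive_cos 0) e7.
have [d3 d30 h3] := is_derive_taylor1 (is_derive_sin 0) e7.
exists (Num.min (Num.min d1 d2) (Num.min d3 (Num.min 1 (e / 7)))).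
  by rewrite !lt_min d10 d20 d30 ltr01 e7.
move=> w; have ra := normc_Re w; have rb := normc_Im w.
rewrite !lt_min => /andP[/andP[w1 w2] /andP[w3 /andP[w4 w5]]].
have {h1} := h1 _ (le_lt_trans ra w1); have {h2} := h2 _ (le_lt_trans rb w2).
have {h3} := h3 _ (le_lt_trans rb w3).
rewrite expR0 cos0 sin0 oppr0 => h3 h2 h1; move: h1 h2 h3; rewrite !mul1r !mul0r !subr0 addr0 => h1 h2 h3; move: h3 h2 h1.
have {w1 w2 w3} : normc w <= e / 7 by rewrite ltW.
have := normc_ge0 w; have := ltW w4; move: ra rb; rewrite {w4 w5} => ra rb N1 N0 Ne h3 h2 h1.
apply: le_trans (normc_ReIm _) _.
have -> : complex.Re (cexp w - 1 - w) =
    expR (complex.Re w) * cos (complex.Im w) - 1 - complex.Re w by clear; case: w => a b /=; ring.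
have -> : complex.Im (cexp w - 1 - w) =
    expR (complex.Re w) * sin (complex.Im w) - complex.Im w by clear; case: w => a b /=; ring.
move: (normc w) (complex.Re w) (complex.Im w) ra rb N1 N0 Ne h3 h2 h1.
move=> N a b ra rb N1 N0 Ne h3 h2 h1.
have cb : `|cos b| <= 1 by rewrite ler_norml cos_geN1 cos_le1.
have sb : `|sin b| <= 1 by rewrite ler_norml sin_geN1 sin_le1.
have -> : expR a * cos b - 1 - a =
  (expR a - 1 - a) * cos b + (1 + a) * (cos b - 1) by ring.
have -> : expR a * sin b - b =
  (expR a - 1 - a) * sin b + (1 + a) * (sin b - b) + a * b by ring.
have a1 : `|1 + a| <= 2 by rewrite (le_trans (ler_normD _ _))// normr1; lra.
have m (x y : R) (X Y : R) : `|x| <= X -> `|y| <= Y -> `|x * y| <= X * Y.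
  by move=> xX yY; rewrite normrM ler_pM.
have q1 := m _ _ _ _ h1 cb; have q2 := m _ _ _ _ a1 h2.
have q3 := m _ _ _ _ h1 sb; have q4 := m _ _ _ _ a1 h3.
have q5 := m _ _ _ _ ra (le_trans rb Ne).
have p1 := ler_normD ((expR a - 1 - a) * cos b) ((1 + a) * (cos b - 1)).
have p2 := ler_normD ((expR a - 1 - a) * sin b + (1 + a) * (sin b - b)) (a * b).
have p3 := ler_normD ((expR a - 1 - a) * sin b) ((1 + a) * (sin b - b)).
have ea : e / 7 * `|a| <= e / 7 * N by rewrite ler_wpM2l// ltW.
have eb : e / 7 * `|b| <= e / 7 * N by rewrite ler_wpM2l// ltW.
lra.
Qed.

(** Chain rule with an arbitrary scale [k x] in place of the inverse increment. It serves
    derivatives in time, derivatives in space, and, with [k = 1] and [v = 0], continuity. *)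
Lemma cvg_cexp_quotient (T : Type) (F : set_system T) {FF : Filter F}
    (k : T -> Cplx R) (E : T -> Cplx R) (E0 v : Cplx R) :
  E x @[x --> F] --> E0 -> k x * (E x - E0) @[x --> F] --> v ->
  k x * (cexp (E x) - cexp E0) @[x --> F] --> (v * cexp E0 : Cplx R).
Proof.
move=> EE0 kv.
(* The remainder is [o(E x - E0)] and [k x * (E x - E0)] is eventually smaller than [normc v + 1],
   so their product tends to 0. *)
have r0 : k x * (cexp (E x - E0) - 1 - (E x - E0)) @[x --> F] --> (0 : Cplx R).
  apply/cvg_normcP => e e0; have Nv1 : 0 < normc v + 2 by have := normc_ge0 v; lra.
  have [d d0 H] := cexp_taylor1 (divr_gt0 e0 Nv1).
  move/cvg_normcP/(_ _ d0) : EE0; move/cvg_normcP/(_ _ ltr01) : kv.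
  apply: filterS2 => x; move: (E x - E0) (k x) => u kx ku /H{}H.
  rewrite subr0 normcMl; apply: le_lt_trans (ler_wpM2l (normc_ge0 _) H) _.
  rewrite mulrCA -normcMl -mulrA -[ltRHS]mulr1 ltr_pM2l// ltr_pdivrMl// mulr1.
  have := normcD (kx * u - v) v; rewrite subrK; lra.
rewrite -[v in X in _ --> X]add0r.
apply: cvg_eq1 (cvgC_mul (cvgC_add r0 kv) (cvgC_cst (cexp E0))) => x.
have -> : cexp (E x) = cexp (E x - E0) * cexp E0 by rewrite -cexpD subrK.
ring.
Qed.

Lemma der_cexp (E dE : R -> Cplx R) : der E dE ->
  der (cexp \o E) (fun s => dE s * cexp (E s)).
Proof.
move=> dE' s s0; apply/derP; apply: cvg_cexp_quotient.
  exact: der_continuous dE' s0.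
by apply/derP; exact: dE'.
Qed.
End ComplexExponential.

(** * Taylor coefficients of curves *)

Section CausalFixpoint.
Variables (V : Type) (v0 : V) (T : (nat -> V) -> nat -> V).
Hypothesis causal : forall a b m, (forall k, (k < m)%N -> a k = b k) ->
  forall k, (k < m.+1)%N -> T a k = T b k.

(** Entry [k] of [T a] depends only on the entries of [a] below [k], so it is final after [k.+1]
    iterations. This allows recursions that pass the whole sequence to an infinite series. *)
Definition causal_fix k := iter k.+1 T (fun=> v0) k.

Lemma iter_causal m k : (k < m)%N -> iter m T (fun=> v0) k = causal_fix k.
Proof.
have step j : forall i, (i < j)%N -> iter j T (fun=> v0) i = iter j.+1 T (fun=> v0) i.
  by elim: j => // j IH i ij; apply: (causal (m := j)).
elim: m => // m IH; rewrite ltnS leq_eqVlt => /predU1P[->//|km].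
by rewrite -step// IH.
Qed.

Lemma causal_fixE k : causal_fix k = T causal_fix k.
Proof. by apply: (causal (m := k)) => // i ik; exact: iter_causal. Qed.
End CausalFixpoint.

(** * Products of Taylor coefficients and a submultiplicative norm *)

Section Jets.
Context {R : realType}.
Implicit Types (f g : nat -> Cplx R) (r : R).

(* A sequence [f] stands for the Taylor coefficients of a curve at some time, so [conv]
   is the coefficient of the product of two curves. *)
Definition conv f g k : Cplx R := \sum_(i < k.+1) f i * g (k - i)%N.

Definition jone (k : nat) : Cplx R := (k == 0)%:R.

Definition jnorm r N f := \sum_(k < N) normc (f k) * r ^+ k.

Lemma conv_ext f f' g g' k : (forall i, (i <= k)%N -> f i = f' i) ->
  (forall i, (i <= k)%N -> g i = g' i) -> conv f g k = conv f' g' k.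
Proof.
move=> ff gg; apply: eq_bigr => i _.
by rewrite ff ?gg ?leq_subr// -ltnS.
Qed.

Lemma jnorm_le r N M f : 0 <= r -> (N <= M)%N -> jnorm r N f <= jnorm r M f.
Proof.
move=> r0 /subnKC <-; rewrite /jnorm big_split_ord/= lerDl sumr_ge0// => i _.
by rewrite mulr_ge0 ?normc_ge0 ?exprn_ge0.
Qed.

Lemma jnorm_coef r N f k : 0 <= r -> (k < N)%N -> normc (f k) * r ^+ k <= jnorm r N f.
Proof.
move=> r0 kN; rewrite /jnorm (bigD1 (Ordinal kN))//= lerDl sumr_ge0// => i _.
by rewrite mulr_ge0 ?normc_ge0 ?exprn_ge0.
Qed.

Lemma jnorm_ge0 r N f : 0 <= r -> 0 <= jnorm r N f.
Proof. by move=> r0; rewrite sumr_ge0// => i _; rewrite mulr_ge0 ?normc_ge0 ?exprn_ge0. Qed.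

(** [jnorm] is the value at [r] of a polynomial with coefficients [normc (f k)]. The product of two
    such polynomials has nonnegative coefficients, so dropping those of order [N] and above only
    decreases the value. *)
Lemma jnorm_conv r N f g : 0 <= r ->
  jnorm r N (conv f g) <= jnorm r N f * jnorm r N g.
Proof.
move=> r0; pose P h := \poly_(i < N) normc (h i : Cplx R).
have hP h : jnorm r N h = (P h).[r] by rewrite horner_poly.
have P0 h i : 0 <= (P h)`_i by rewrite coef_poly; case: ifP; rewrite ?normc_ge0.
rewrite (hP f) (hP g) -hornerM (@horner_coef_wide _ (N + N)); last first.
  apply: leq_trans (size_polyMleq _ _) _; apply: leq_trans (leq_pred _) _.
  by rewrite leq_add// size_poly.
rewrite big_split_ord/=; apply: le_trans (_ : _ <= \sum_(i < N) (P f * P g)`_i * r ^+ i) _.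
  apply: ler_sum => k _; rewrite ler_wpM2r ?exprn_ge0//.
  rewrite coefM; apply: le_trans (normc_sum _ _ _) _; apply: ler_sum => i _.
  rewrite normcMl !coef_poly (leq_ltn_trans (leq_subr _ _))//.
  by rewrite (leq_ltn_trans _ (ltn_ord k)) // -ltnS.
rewrite lerDl sumr_ge0// => i _; rewrite mulr_ge0 ?exprn_ge0// coefM sumr_ge0// => j _.
by rewrite mulr_ge0.
Qed.

Lemma jnorm_jone r N : 0 <= r -> jnorm r N jone <= 1.
Proof.
case: N => [|N] r0; first by rewrite /jnorm big_ord0.
rewrite /jnorm big_ord_recl big1 => [|i _]; last first.
  by rewrite (_ : jone _ = 0) ?ComplexField.Normc.normc0 ?mul0r.
by rewrite (_ : jone _ = 1) ?ComplexField.Normc.normc1 ?expr0 ?mul1r ?addr0.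
Qed.

Lemma conv0 f g : conv f g 0 = f 0%N * g 0%N.
Proof. by rewrite /conv big_ord1. Qed.

(* The Leibniz rule, for [f k = F^(k) / k`!]. *)
Lemma conv_succ f g k :
  \sum_(i < k.+1) ((i.+1)%:R * f i.+1 * g (k - i)%N + f i * ((k - i).+1%:R * g (k - i).+1))
  = k.+1%:R * conv f g k.+1.
Proof.
rewrite big_split/= /conv mulr_sumr.
rewrite (eq_bigr (fun i : 'I_k.+2 => i%:R * f i * g (k.+1 - i)%N
    + f i * ((k.+1 - i)%:R * g (k.+1 - i)%N))); last first.
  move=> i _; have : (k.+1%:R : Cplx R) = i%:R + (k.+1 - i)%:R.
    by rewrite -natrD subnKC// -ltnS.
  by move=> ->; ring.
rewrite big_split/=; congr (_ + _).
  by rewrite [RHS]big_ord_recl/= mulr0n !mul0r add0r; apply: eq_bigr => i _; rewrite /bump/= add1n subSS.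
rewrite [RHS]big_ord_recr/= subnn mulr0n mul0r mulr0 addr0; apply: eq_bigr => i _.
by rewrite subSn// -ltnS.
Qed.

(** The cut-off [K] makes the lemma usable inside strong inductions, where the derivatives are known
    only for the first coefficients. *)
Lemma conv_der (f g : nat -> R -> Cplx R) K :
  (forall k, (k <= K)%N -> der (f k) (fun s => k.+1%:R * f k.+1 s)) ->
  (forall k, (k <= K)%N -> der (g k) (fun s => k.+1%:R * g k.+1 s)) ->
  forall k, (k <= K)%N ->
    der (fun s => conv (f^~ s) (g^~ s) k) (fun s => k.+1%:R * conv (f^~ s) (g^~ s) k.+1).
Proof.
move=> fd gd k kK.
have H : der (fun s => \sum_(i < k.+1) f i s * g (k - i)%N s)
  (fun s => \sum_(i < k.+1) ((i.+1)%:R * f i.+1 s * g (k - i)%N s +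
     f i s * ((k - i).+1%:R * g (k - i).+1 s))).
  apply: der_sum => i _; apply: derM.
    by apply: fd; rewrite (leq_trans _ kK)// -ltnS.
  by apply: gd; rewrite (leq_trans _ kK)// leq_subr.
by apply: der_ext H => // s _; exact: (conv_succ (f^~ s) (g^~ s) k).
Qed.
End Jets.

Section Words.
Context {n : nat}.

(** Listing the directions of [al] with multiplicity turns [mderiv], [mpow] and [jmon] into folds
    over one list, so that each is handled by a plain list induction. *)
Definition word (al : mindex n) : seq 'I_n := flatten [seq nseq (al i) i | i <- enum 'I_n].

Lemma foldr_word (V : Type) (h : 'I_n -> V -> V) (z : V) (al : mindex n) :
  foldr (fun j g => iter (al j) (h j) g) z (enum 'I_n) = foldr h z (word al).
Proof.
rewrite /word; elim: (enum 'I_n) => //= j s ->; rewrite foldr_cat.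
by elim: (al j) => //= k ->.
Qed.

Lemma size_word al : size (word al) = mdeg al.
Proof.
rewrite /word size_flatten /shape -map_comp sumnE big_map /mdeg big_enum/=.
by apply: eq_bigr => i _; rewrite size_nseq.
Qed.

Lemma prod_word (R : realType) (z : 'I_n -> R[i]) al : \prod_(j <- word al) z j = mpow z al.
Proof.
rewrite /word big_flatten/= big_map big_enum/=; apply: eq_bigr => i _.
by rewrite big_nseq iter_mulr_1.
Qed.
End Words.

(** * Composition of a power series in several variables with a curve *)

Section JetMonomials.
Context {R : realType} {n : nat}.
Implicit Types (a : nat -> 'I_n -> Cplx R) (r : R) (al : mindex n) (phi : mindex n -> Cplx R).

(* Taylor coefficients of the monomial [al] in the curves with coefficients [a ^~ j]. *)
Definition jmon a al : nat -> Cplx R := foldr (fun i g => conv (a^~ i) g) jone (word al).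

Lemma jmon0 a al : jmon a al 0 = mpow (a 0%N) al.
Proof.
rewrite -prod_word /jmon; elim: (word al) => [|j s IH] /=; first by rewrite big_nil.
by rewrite conv0 IH big_cons.
Qed.

Lemma jmon_ext a b al k : (forall i, (i <= k)%N -> a i = b i) -> jmon a al k = jmon b al k.
Proof.
rewrite /jmon; elim: (word al) k => //= j s IH k ab.
apply: conv_ext => i ik; first by rewrite ab.
by apply: IH => l li; apply: ab; exact: leq_trans li ik.
Qed.

Lemma jnorm_jmon r N a al (rho : R) : 0 <= r -> (forall j, jnorm r N (a^~ j) <= rho) ->
  jnorm r N (jmon a al) <= rho ^+ mdeg al.
Proof.
move=> r0 ar; rewrite -size_word /jmon; elim: (word al) => [|j s IH] /=.
  by rewrite expr0 jnorm_jone.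
apply: le_trans (jnorm_conv _ _ _ r0) _.
by rewrite exprS; apply: ler_pM => //; exact: jnorm_ge0.
Qed.

Lemma jmon_der (a : nat -> R -> 'I_n -> Cplx R) al K :
  (forall k j, (k <= K)%N -> der (fun s => a k s j) (fun s => k.+1%:R * a k.+1 s j)) ->
  forall k, (k <= K)%N ->
    der (fun s => jmon (a^~ s) al k) (fun s => k.+1%:R * jmon (a^~ s) al k.+1).
Proof.
move=> ad; rewrite /jmon; elim: (word al) => [|j s IH] k kK /=.
  by apply: der_ext (der_cst (jone k)) => // t _; rewrite /jone mulr0.
pose g k t := foldr (fun i g => conv (fun k => a k t i) g) jone s k.
exact: (@conv_der _ (fun k t => a k t j) g K (fun i iK => ad i j iK) IH k kK).
Qed.

(** The value is 0 when the family is not summable; [msumP] excludes that case under a majorant. *)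
Definition msum phi : Cplx R := xget 0 [set v | sums phi v].

(** The Taylor coefficient of order [k] of the composition of the power series with coefficients
    [phi] and the curve with coefficients [a]. *)
Definition jseries phi a k := msum (fun al => phi al * jmon a al k).

(** Absolute convergence on the closed polydisc of radius [rho], with sum at most [K]. *)
Definition summable_at phi (rho K : R) := majorant (fun al => normc (phi al) * rho ^+ mdeg al) K.

Lemma msumP phi m B : (forall al, normc (phi al) <= m al) -> majorant m B ->
  sums phi (msum phi).
Proof. by move=> pm mB; have := majorized_sums pm mB; exact: xgetPex. Qed.

Lemma majorantZ (m : mindex n -> R) (B k : R) : 0 <= k -> majorant m B ->
  majorant (fun al => k * m al) (k * B).
Proof.
move=> k0 [m0 mB]; split=> [al|J]; first by rewrite mulr_ge0.
by rewrite -mulr_sumr ler_wpM2l.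
Qed.

Lemma jmon_le r a al rho k : 0 < r -> (forall j, jnorm r k.+1 (a^~ j) <= rho) ->
  normc (jmon a al k) <= r ^- k * rho ^+ mdeg al.
Proof.
move=> r0 ar; rewrite ler_pdivlMl ?exprn_gt0// mulrC.
by apply: le_trans (jnorm_jmon al (ltW r0) ar); apply: jnorm_coef; rewrite ?ltW.
Qed.

Lemma jseries_term_le phi r a al rho k : 0 < r -> (forall j, jnorm r k.+1 (a^~ j) <= rho) ->
  normc (phi al * jmon a al k) <= r ^- k * (normc (phi al) * rho ^+ mdeg al).
Proof.
move=> r0 ar; rewrite normcMl mulrCA ler_wpM2l ?normc_ge0//.
exact: jmon_le.
Qed.

Lemma jseriesP phi r a rho K k : 0 < r -> summable_at phi rho K ->
  (forall j, jnorm r k.+1 (a^~ j) <= rho) ->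
  sums (fun al => phi al * jmon a al k) (jseries phi a k).
Proof.
move=> r0 pK ar; apply: msumP (majorantZ (_ : 0 <= r ^- k) pK).
  by move=> al; exact: jseries_term_le.
by rewrite invr_ge0 exprn_ge0// ltW.
Qed.

Lemma jseries_ext phi a b k : (forall i, (i <= k)%N -> a i = b i) ->
  jseries phi a k = jseries phi b k.
Proof.
by move=> ab; congr msum; apply/funext => al; rewrite (jmon_ext _ ab).
Qed.

(** For a finite set [J] of multi-indices the sums over [k] and [al] can be exchanged, and
    [jnorm_jmon] bounds each monomial; the bound survives the limit in [J] because [jnorm] involves
    only [N] coefficients. *)
Lemma jnorm_jseries phi r a rho K N : 0 < r -> summable_at phi rho K ->
  (forall j, jnorm r N (a^~ j) <= rho) -> jnorm r N (jseries phi a) <= K.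
Proof.
move=> r0 pK ar.
have cv : \sum_(k < N) normc (usum (fun al => phi al * jmon a al k) J) * r ^+ k
    @[J --> @totally (mindex n)] --> jnorm r N (jseries phi a).
  apply: cvg_big => [|k _]; first exact: add_continuous.
  apply: cvgM; last exact: cvg_cst.
  apply: cvg_normc; apply: (@jseriesP _ r _ rho K) => // j.
  by apply: le_trans (ar j); apply: jnorm_le; rewrite ?ltW.
apply: (cvgr_to_le cv); apply: nearW => J.
apply: le_trans (pK.2 J).
apply: (@le_trans _ _ (\sum_(k < N) \sum_(al <- enum_fset J) normc (phi al) * (normc (jmon a al k) * r ^+ k))).
  apply: ler_sum => k _; under [leRHS]eq_bigr do rewrite mulrA -normcMl.
  by rewrite -mulr_suml ler_wpM2r ?exprn_ge0 ?(ltW r0)// normc_sum.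
rewrite exchange_big/=; apply: ler_sum => al _; rewrite -mulr_sumr.
by rewrite ler_wpM2l ?normc_ge0// -/(jnorm r N (jmon a al)) jnorm_jmon// ltW.
Qed.

(** Termwise differentiation. The bound on the jets is required at all times because the difference
    quotients are controlled by derivatives at intermediate times. *)
Lemma jseries_der phi (a : nat -> R -> 'I_n -> Cplx R) r rho K k : 0 < r ->
  summable_at phi rho K ->
  (forall N s j, 0 <= s -> jnorm r N (fun i => a i s j) <= rho) ->
  (forall i j, (i <= k)%N -> der (fun s => a i s j) (fun s => i.+1%:R * a i.+1 s j)) ->
  der (fun s => jseries phi (a^~ s) k) (fun s => k.+1%:R * jseries phi (a^~ s) k.+1).
Proof.
move=> r0 pK ar ad s s0; apply/derP.
pose F s al : Cplx R := phi al * jmon (a^~ s) al k.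
pose F' s al : Cplx R := k.+1%:R * (phi al * jmon (a^~ s) al k.+1).
(* The derivative of a term carries the factor [k.+1] and a coefficient of order [k.+1], whence
   [r ^- k.+1]; the 2 in [m] is the one of [der_le_norm]. *)
pose c := k.+1%:R * r ^- k.+1.
have c0 : 0 <= c by rewrite mulr_ge0// invr_ge0 exprn_ge0// ltW.
pose m al := 2 * (c * (normc (phi al) * rho ^+ mdeg al)).
have F'm t al : 0 <= t -> normc (F' t al) <= c * (normc (phi al) * rho ^+ mdeg al).
  move=> t0; rewrite /F' normcMl normc_nat /c -mulrA ler_wpM2l//.
  by apply: jseries_term_le => // j; exact: ar.
have dF al : der (F ^~ al) (F' ^~ al).
  have jd := @jmon_der a al k (fun i j ik => ad i j ik) k (leqnn k).
  apply: der_ext (derZ (k := phi al) jd) => //.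
  by move=> t _; rewrite /F' mulrCA.
have mB := majorantZ (ler0n R 2) (majorantZ c0 pK).
(* The mean value theorem dominates the difference quotients of the terms. *)
apply: (sums_dominated (I := mindex n) (f := fun h al => (h%:C)^-1 * (F (s + h) al - F s al))
  (g := F' s) mB).
- apply: filterS (near_incr s) => h [h0 sh] al.
  rewrite normcMl ComplexField.Normc.normcV normcR ler_pdivrMl ?normr_gt0//.
  have := @der_le_norm _ _ _ s (s + h) (c * (normc (phi al) * rho ^+ mdeg al)) (dF al) s0 sh.
  rewrite (addrC s h) addrK [leRHS]mulrC; apply=> t /andP[t0 _]; apply: F'm.
  by apply: le_trans t0; rewrite le_min s0 addrC.
- move=> al; apply: le_trans (F'm _ _ s0) _; rewrite ler_peMl// ?ler1n//.
  by apply: le_trans (F'm _ _ s0); exact: normc_ge0.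
- by move=> al; have /derP := dF al s s0.
- apply: filterS (near_incr s) => h [h0 sh]; apply: sumsZ; apply: sumsD.
    by apply: (@jseriesP _ r _ rho K) => // j; exact: ar.
  rewrite -mulN1r; under eq_fun do rewrite -mulN1r; apply: sumsZ.
  by apply: (@jseriesP _ r _ rho K) => // j; exact: ar.
- by apply: sumsZ; apply: (@jseriesP _ r _ rho K) => // j; exact: ar.
Qed.
End JetMonomials.

(** * Taylor coefficients of the nonlinear system for [D] *)

Section Flow.
Context {R : realType} {n : nat} (psi : 'I_n -> mindex n -> Cplx R).

(* Taylor coefficients at the start of the solution of [y_j' = \sum_al psi_j,al y^al]
   issued from [y]. *)
Definition flow_jet (y : 'I_n -> Cplx R) : nat -> 'I_n -> Cplx R :=
  causal_fix (fun=> 0) (fun a k => if k is k'.+1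
    then fun j => k'.+1%:R^-1 * jseries (psi j) a k' else y).

Lemma flow_jetE y k : flow_jet y k = if k is k'.+1
  then fun j => k'.+1%:R^-1 * jseries (psi j) (flow_jet y) k' else y.
Proof.
rewrite /flow_jet causal_fixE// => a b m ab [//|i] im.
by apply/funext => j; rewrite (@jseries_ext _ _ _ a b)// => l li; apply: ab; exact: leq_ltn_trans li _.
Qed.

(* [jnorm] is submultiplicative, so by induction on [N] the truncated jets stay in the
   ball of radius [M + 1], exactly as Picard iterates would. *)
Lemma flow_jet_norm y r (M K : R) N j : 0 < r -> r * K <= 1 ->
  (forall j, normc (y j) <= M) -> (forall j, summable_at (psi j) (M + 1) K) ->
  jnorm r N (fun k => flow_jet y k j) <= M + 1.
Proof.
move=> r0 rK yM pK; elim: N j => [|N IH] j.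
  by rewrite /jnorm big_ord0 addr_ge0// (le_trans _ (yM j))// normc_ge0.
(* The term of order 0 is at most [M]. Each later term gives up one factor [r] and a factor
   [k.+1^-1 <= 1], so together they are at most [r * K <= 1]. *)
rewrite /jnorm big_ord_recl/= flow_jetE expr0 mulr1; apply: lerD => //.
have h : jnorm r N (jseries (psi j) (flow_jet y)) <= K by exact: jnorm_jseries (pK j) IH.
apply: le_trans rK; apply: le_trans (ler_wpM2l (ltW r0) h).
rewrite /jnorm mulr_sumr; apply: ler_sum => k _; rewrite /bump/= add1n flow_jetE.
rewrite normcMl ComplexField.Normc.normcV normc_nat exprS mulrCA ler_wpM2l ?(ltW r0)//.
rewrite ler_wpM2r ?exprn_ge0 ?(ltW r0)// ler_piMl ?normc_ge0//.
by rewrite invf_le1 ?ler1n.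
Qed.

(** The coefficients depend on time only through [D s], so differentiating the recursion gives the
    next coefficient. [jseries] of order [k] involves jets up to order [k] only, which makes strong
    induction possible. *)
Lemma flow_jet_der (D : R -> 'I_n -> Cplx R) r (M K : R) : 0 < r -> r * K <= 1 ->
  (forall s j, 0 <= s -> normc (D s j) <= M) -> (forall j, summable_at (psi j) (M + 1) K) ->
  (forall j, der (D^~ j) (fun s => jseries (psi j) (flow_jet (D s)) 0)) ->
  forall k j, der (fun s => flow_jet (D s) k j) (fun s => k.+1%:R * flow_jet (D s) k.+1 j).
Proof.
move=> r0 rK DM pK Dd k; elim/ltn_ind: k => -[|k] IH j.
  apply: der_ext (Dd j) => s _; first by rewrite flow_jetE.
  by rewrite flow_jetE mulrA divff ?mul1r// pnatr_eq0.
have ar N s i : 0 <= s -> jnorm r N (fun l => flow_jet (D s) l i) <= M + 1.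
  by move=> s0; apply: flow_jet_norm rK _ pK => // l; exact: DM.
have h := @jseries_der _ _ (psi j) (fun l s => flow_jet (D s) l) r _ _ k r0 (pK j) ar
  (fun i j ik => IH i ik j).
apply: der_ext (derZ (k := k.+1%:R^-1) h) => s _; first by rewrite [in RHS]flow_jetE.
by rewrite mulrA mulVf ?mul1r ?pnatr_eq0// [in RHS]flow_jetE mulrA divff ?mul1r// pnatr_eq0.
Qed.
End Flow.

(** * Taylor coefficients of a scalar linear equation *)

Section ExponentialJet.
Context {R : realType}.
Implicit Types (w : nat -> Cplx R).

(* Taylor coefficients at the start of the solution of [q' = w q], [q(0) = q0]. *)
Definition exp_jet w (q0 : Cplx R) : nat -> Cplx R :=
  causal_fix 0 (fun q k => if k is k'.+1 then k'.+1%:R^-1 * conv w q k' else q0).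

Lemma exp_jetE w q0 k : exp_jet w q0 k =
  if k is k'.+1 then k'.+1%:R^-1 * conv w (exp_jet w q0) k' else q0.
Proof.
rewrite /exp_jet causal_fixE// => a b m ab [//|i] im.
by rewrite (@conv_ext _ w w a b)// => l li; apply: ab; exact: leq_ltn_trans li _.
Qed.

(** The induction of [flow_jet_norm], now for a linear equation: with [r * W <= 1 / 2] the terms of
    positive order take at most half of the claimed bound, and the initial value takes the other
    half. *)
Lemma exp_jet_norm w q0 (r W : R) N : 0 < r -> r * W <= 1 / 2 ->
  (forall N, jnorm r N w <= W) -> jnorm r N (exp_jet w q0) <= 2 * normc q0.
Proof.
move=> r0 rW wW; elim: N => [|N IH].
  by rewrite /jnorm big_ord0 mulr_ge0 ?normc_ge0.
rewrite /jnorm big_ord_recl/= exp_jetE expr0 mulr1 mulr2n mulrDl !mul1r lerD2l.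
have h : r * jnorm r N (conv w (exp_jet w q0)) <= r * W * (2 * normc q0).
  rewrite -mulrA ler_wpM2l ?(ltW r0)//; apply: le_trans (jnorm_conv _ _ _ (ltW r0)) _.
  by apply: ler_pM => //; apply: jnorm_ge0; rewrite ltW.
have h2 : r * W * (2 * normc q0) <= 1 / 2 * (2 * normc q0).
  by rewrite ler_wpM2r// mulr_ge0// normc_ge0.
apply: le_trans (_ : r * jnorm r N (conv w (exp_jet w q0)) <= _); last by lra.
rewrite /jnorm mulr_sumr; apply: ler_sum => k _; rewrite /bump/= add1n exp_jetE.
rewrite normcMl ComplexField.Normc.normcV normc_nat exprS mulrCA ler_wpM2l ?(ltW r0)//.
rewrite ler_wpM2r ?exprn_ge0 ?(ltW r0)// ler_piMl ?normc_ge0//.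
by rewrite invf_le1 ?ler1n.
Qed.

Lemma exp_jet_der (w : nat -> R -> Cplx R) (q0 : R -> Cplx R) :
  (forall k, der (w k) (fun s => k.+1%:R * w k.+1 s)) ->
  der q0 (fun s => w 0%N s * q0 s) ->
  forall k, der (fun s => exp_jet (w^~ s) (q0 s) k)
    (fun s => k.+1%:R * exp_jet (w^~ s) (q0 s) k.+1).
Proof.
move=> wd qd k; elim/ltn_ind: k => -[|k] IH.
  apply: der_ext qd => s _; first by rewrite exp_jetE.
  by rewrite exp_jetE conv0 mulrA divff ?mul1r ?pnatr_eq0// exp_jetE.
have h := @conv_der _ w (fun l s => exp_jet (w^~ s) (q0 s) l) k
  (fun i _ => wd i) (fun i ik => IH i ik) k (leqnn k).
apply: der_ext (derZ (k := k.+1%:R^-1) h) => s _; first by rewrite [in RHS]exp_jetE.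
by rewrite mulrA mulVf ?mul1r ?pnatr_eq0// [in RHS]exp_jetE mulrA divff ?mul1r// pnatr_eq0.
Qed.
End ExponentialJet.

(** * Taylor and power series *)

Section TaylorSeries.
Context {R : realType}.

Lemma der_sub (b : R) : der (fun s => (b - s)%:C) (fun=> -1).
Proof.
move=> s s0; apply/derP; apply: near_cvg_eq (cvgC_cst (-1)).
apply: filterS (near_incr s) => h [h0 _].
have -> : (b - (s + h))%:C - (b - s)%:C = - h%:C :> Cplx R.
  by rewrite -raddfB -raddfN/=; congr (_%:C); ring.
by rewrite mulrN mulVf// (inj_eq (@complexI R) h 0).
Qed.

Lemma der_subX (b : R) k : der (fun s => (b - s)%:C ^+ k.+1) (fun s => - (k.+1%:R * (b - s)%:C ^+ k)).
Proof.
elim: k => [|k IH]; first by apply: der_ext (@der_sub b) => s _; rewrite ?expr1 ?expr0 ?mulr1.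
apply: der_ext (derM (@der_sub b) IH) => s _; first by rewrite -exprS.
by rewrite -[k.+2%:R]natr1 !exprS; ring.
Qed.

(* The Taylor polynomial at a moving centre has a telescoping derivative, so the mean
   value theorem bounds the remainder. *)
Lemma der_taylor_sum (f : nat -> R -> Cplx R) (b : R) N :
  (forall k, der (f k) (fun s => k.+1%:R * f k.+1 s)) ->
  der (fun s => \sum_(k < N.+1) f k s * (b - s)%:C ^+ k)
    (fun s => N.+1%:R * f N.+1 s * (b - s)%:C ^+ N).
Proof.
move=> fd; elim: N => [|N IH].
  by apply: der_ext (fd 0%N) => s _; rewrite ?big_ord1 expr0 mulr1.
apply: der_ext (derD IH (derM (fd N.+1) (@der_subX b N))) => s _.
  by rewrite [RHS]big_ord_recr.
by ring.
Qed.

Lemma natr_exp2 (k : nat) : (k.+1%:R : R) <= 2 ^+ k.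
Proof. by rewrite -natrX ler_nat ltn_expl. Qed.

Lemma cvg_cst_exp2 (B : R) : B * 2^-1 ^+ N @[N --> \oo] --> 0.
Proof.
rewrite -[X in _ --> X](mulr0 B); apply: cvgM; first exact: cvg_cst.
by apply: cvg_expr; rewrite ger0_norm// invf_lt1// ltr1n.
Qed.

Lemma taylor_series (f : nat -> R -> Cplx R) (a b r B : R) :
  (forall k, der (f k) (fun s => k.+1%:R * f k.+1 s)) ->
  0 <= a -> 0 <= b -> 0 < r -> 4 * `|b - a| <= r ->
  (forall k s, Num.min a b <= s <= Num.max a b -> normc (f k s) <= B * r ^- k) ->
  series (fun k => (b - a)%:C ^+ k * f k a) @ \oo --> f 0%N b.
Proof.
move=> fd a0 b0 r0 abr fB.
have B0 : 0 <= B.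
  have := fB 0%N a; rewrite expr0 invr1 mulr1 => h; apply: le_trans (h _); first exact: normc_ge0.
  by rewrite ge_min lexx le_max lexx.
apply: (cvg_sub_normc (g := fun N => B * 2 * 2^-1 ^+ N)); last exact: cvg_cst_exp2.
(* The partial sum with [N.+1] terms is the Taylor polynomial of degree [N]; the target bound
   becomes [B * 2^-1 ^+ N]. *)
exists 1%N => // -[//|N] _; rewrite exprS mulrA mulfK//.
have dT := @der_taylor_sum f b N fd.
(* At centre [b] only the constant term survives, while at centre [a] the sum is the partial sum;
   the remainder is the variation between the two centres. *)
have eb : \sum_(k < N.+1) f k b * (b - b)%:C ^+ k = f 0%N b.
  rewrite big_ord_recl/= expr0 mulr1 big1 ?addr0// => i _.
  by rewrite subrr expr0n/= mulr0.
rewrite normcB -{1}eb.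
rewrite big_mkord; under [X in _ - X]eq_bigr do rewrite mulrC.
have := @der_le_norm _ _ _ a b (N.+1%:R * (B * r ^- N.+1) * `|b - a| ^+ N) dT a0 b0.
move=> h; apply: le_trans (h _) _ => [s sab|].
  rewrite !normcMl normc_nat normcX normcR; apply: ler_pM => //.
  - by rewrite mulr_ge0// normc_ge0.
  - by rewrite ler_wpM2l// fB.
  - apply: lerXn2r; rewrite ?nnegrE//; move: sab; case: (leP a b) => ab /andP[h1 h2].
      by rewrite !ger0_norm; lra.
    by rewrite !ler0_norm; lra.
(* Of [4^-1 = 2^-1 * 2^-1], one power of [2^-1] absorbs the factor [N.+1] and the other gives the
   geometric decay. *)
have q4 : `|b - a| / r <= 4^-1 by rewrite ler_pdivrMr//; lra.
have -> : 2 * (N.+1%:R * (B * r ^- N.+1) * `|b - a| ^+ N) * `|b - a| =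
    2 * N.+1%:R * B * (`|b - a| / r) ^+ N.+1.
  by rewrite expr_div_n !exprS; field; rewrite ?gt_eqF// exprn_gt0.
have : (`|b - a| / r) ^+ N.+1 <= 4^-1 ^+ N.+1.
  by apply: lerXn2r => //; rewrite nnegrE ?invr_ge0// divr_ge0// ltW.
have p0 : 0 <= 2 * N.+1%:R * B by rewrite !mulr_ge0.
move/(ler_wpM2l p0)/le_trans; apply.
have -> : (4^-1 : R) ^+ N.+1 = 2^-1 ^+ N.+1 * 2^-1 ^+ N.+1.
  by rewrite -exprMn; congr (_ ^+ N.+1); field.
have e2 : (N.+1%:R : R) * 2^-1 ^+ N <= 1.
  by rewrite exprVn ler_pdivrMr ?exprn_gt0// mul1r natr_exp2.
have p1 : 0 <= B * 2^-1 ^+ N.+1 by rewrite mulr_ge0// exprn_ge0.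
have := ler_wpM2l p1 e2; rewrite mulr1 !exprS => h1.
have h2 : 0 <= B * 2^-1 ^+ N by rewrite mulr_ge0// exprn_ge0.
move: h1 h2; set x := (2^-1 : R) ^+ N; set y := (N.+1%:R : R) => h1 h2.
lra.
Qed.

Lemma series_cvg_geo (u : nat -> Cplx R) (B : R) :
  (forall k, normc (u k) <= B * 2^-1 ^+ k) -> exists l : Cplx R, series u @ \oo --> l.
Proof.
move=> uB.
have cv (v : nat -> R) : (forall k, `|v k| <= B * 2^-1 ^+ k) -> cvgn (series v).
  move=> vB; apply: normed_cvg; apply: (series_le_cvg _ _ vB) => [k|k|] //.
    exact: le_trans (vB k).
  by apply: is_cvg_geometric_series; rewrite ger0_norm// invf_lt1// ltr1n.
have /cv/cvg_ex[x hx] k : `|complex.Re (u k)| <= B * 2^-1 ^+ k.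
  exact: le_trans (normc_Re _) (uB k).
have /cv/cvg_ex[y hy] k : `|complex.Im (u k)| <= B * 2^-1 ^+ k.
  exact: le_trans (normc_Im _) (uB k).
exists (x +i* y); apply: cvg_ReIm.
  by apply: cvg_eq1 hx => N; rewrite /series/= raddf_sum.
by apply: cvg_eq1 hy => N; rewrite /series/= raddf_sum.
Qed.

(** Induction on [k] multiplies the remainder by [z + h] and adds [k h^2 z^(k-1)]. The coefficient
    [k^2] closes it through [k^2 + k <= (k+1)^2]; at [k = 0] the value of [k.-1] is harmless because
    of the factor [k]. *)
Lemma expr_taylor2 (z h : Cplx R) (sg : R) k : 0 < sg -> normc z <= sg -> normc (z + h) <= sg ->
  normc ((z + h) ^+ k - z ^+ k - k%:R * h * z ^+ k.-1) <=
    k%:R ^+ 2 * sg ^+ k * sg ^- 2 * normc h ^+ 2.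
Proof.
move=> s0 zs zhs; elim: k => [|k IH].
  by rewrite !expr0 mulr0n !mul0r subrr subr0 ComplexField.Normc.normc0 expr0n/= !mul0r.
have -> : (z + h) ^+ k.+1 - z ^+ k.+1 - k.+1%:R * h * z ^+ k.+1.-1 =
  (z + h) * ((z + h) ^+ k - z ^+ k - k%:R * h * z ^+ k.-1) + k%:R * h ^+ 2 * z ^+ k.-1.
  by case: k {IH} => [|k] /=; rewrite -?[k.+2%:R]natr1 ?mulr0n !exprS ?expr0; ring.
apply: le_trans (normcD _ _) _; rewrite !normcMl !normcX normc_nat.
have h1 : normc (z + h) * normc ((z + h) ^+ k - z ^+ k - k%:R * h * z ^+ k.-1) <=
    sg * (k%:R ^+ 2 * sg ^+ k * sg ^- 2 * normc h ^+ 2).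
  by apply: ler_pM => //; exact: normc_ge0.
have h2 : k%:R * normc h ^+ 2 * normc z ^+ k.-1 <= k%:R * normc h ^+ 2 * (sg ^+ k.+1 * sg ^- 2).
  case: k {IH h1} => [|k]; first by rewrite mulr0n !mul0r.
  rewrite ler_wpM2l//; first by rewrite mulr_ge0// sqr_ge0.
  rewrite -[k.+2]addn2 exprD mulfK ?expf_neq0 ?gt_eqF//=.
  apply: lerXn2r => //; rewrite nnegrE ?normc_ge0 ?ltW//.
apply: le_trans (lerD h1 h2) _.
set x := sg ^- 2 * normc h ^+ 2; have x0 : 0 <= sg ^+ k.+1 * x.
  by rewrite !mulr_ge0 ?invr_ge0 ?exprn_ge0 ?normc_ge0 ?ltW.
have -> : sg * (k%:R ^+ 2 * sg ^+ k * sg ^- 2 * normc h ^+ 2) +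
    k%:R * normc h ^+ 2 * (sg ^+ k.+1 * sg ^- 2) = (k%:R ^+ 2 + k%:R) * (sg ^+ k.+1 * x).
  by rewrite /x [sg ^+ k.+1]exprS; ring.
have -> : k.+1%:R ^+ 2 * sg ^+ k.+1 * sg ^- 2 * normc h ^+ 2 = k.+1%:R ^+ 2 * (sg ^+ k.+1 * x).
  by rewrite /x; ring.
apply: ler_wpM2r => //; rewrite -[k.+1%:R]natr1.
have : 0 <= k%:R :> R by [].
rewrite !expr2; nra.
Qed.

(** Increments range over [R[i]], so [derivable F z 1] is complex differentiability. The termwise
    derivative series is the candidate, and a quadratic bound on the remainder proves it correct. *)
Lemma power_series_derivable (q : nat -> Cplx R) (B r : R) : 0 < r ->
  (forall k, normc (q k) <= B * r ^- k) ->
  exists F : Cplx R -> Cplx R,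
    (forall z, normc z < r / 16 -> series (fun k => z ^+ k * q k) @ \oo --> F z) /\
    (forall z, normc z < r / 16 -> derivable F z 1).
Proof.
move=> r0 qB.
have B0 : 0 <= B by have := qB 0%N; rewrite expr0 invr1 mulr1; apply: le_trans; exact: normc_ge0.
(* With [z] and [h] both below [r / 16], the point [z + h] stays within [sg]. The ratio [1/8] is
   three factors [1/2]: two absorb [k^2] and one is left for convergence. *)
pose sg := r / 8; have s0 : 0 < sg by rewrite divr_gt0.
have sq k : sg ^+ k * normc (q k) <= B * 8^-1 ^+ k.
  rewrite /sg expr_div_n exprVn mulrAC; apply: ler_wpM2r; first by rewrite invr_ge0 exprn_ge0.
  by rewrite mulrC -ler_pdivlMr ?exprn_gt0.
have k8 k : (k%:R : R) ^+ 2 * 8^-1 ^+ k <= 2^-1 ^+ k.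
  have h : (k%:R : R) * 2^-1 ^+ k <= 1.
    by rewrite exprVn ler_pdivrMr ?exprn_gt0// mul1r -natrX ler_nat ltnW// ltn_expl.
  have -> : (8^-1 : R) ^+ k = 2^-1 ^+ k * 2^-1 ^+ k * 2^-1 ^+ k.
    by rewrite -!exprMn; congr (_ ^+ k); field.
  have -> : (k%:R : R) ^+ 2 * (2^-1 ^+ k * 2^-1 ^+ k * 2^-1 ^+ k) =
     (k%:R * 2^-1 ^+ k) ^+ 2 * 2^-1 ^+ k by ring.
  by rewrite ler_piMl ?exprn_ge0// exprn_ile1// mulr_ge0// exprn_ge0.
have cvF z : normc z <= sg -> exists l : Cplx R, series (fun k => z ^+ k * q k) @ \oo --> l.
  move=> zs; apply: (@series_cvg_geo _ B) => k; rewrite normcMl normcX.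
  apply: le_trans (_ : sg ^+ k * normc (q k) <= _).
    by rewrite ler_wpM2r ?normc_ge0// lerXn2r// nnegrE ?normc_ge0// ltW.
  apply: le_trans (sq k) _; rewrite ler_wpM2l// lerXn2r// ?nnegrE ?invr_ge0//; lra.
have cvG z : normc z <= sg ->
    exists l : Cplx R, series (fun k => k%:R * z ^+ k.-1 * q k) @ \oo --> l.
  move=> zs; apply: (@series_cvg_geo _ (sg^-1 * B)) => k; rewrite !normcMl normcX normc_nat.
  apply: le_trans (_ : k%:R * (sg^-1 * sg ^+ k) * normc (q k) <= _).
    case: k => [|k]; first by rewrite !mul0r.
    rewrite ler_wpM2r ?normc_ge0// ler_wpM2l// exprS mulrA mulVf ?gt_eqF// mul1r.
    by rewrite lerXn2r// nnegrE ?normc_ge0// ltW.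
  have -> : k%:R * (sg^-1 * sg ^+ k) * normc (q k) = sg^-1 * (k%:R * (sg ^+ k * normc (q k))) by ring.
  rewrite -mulrA ler_wpM2l ?invr_ge0 ?(ltW s0)//.
  apply: le_trans (_ : k%:R * (B * 8^-1 ^+ k) <= _).
    by rewrite ler_wpM2l.
  rewrite mulrCA ler_wpM2l//; apply: le_trans (k8 k); rewrite ler_wpM2r ?exprn_ge0//.
  by case: k => [|k]; rewrite ?expr0n// expr2 ler_peMl// ler1n.
pose F z : Cplx R := xget 0 [set l | series (fun k => z ^+ k * q k) @ \oo --> l].
have FP z : normc z <= sg -> series (fun k => z ^+ k * q k) @ \oo --> F z.
  by move=> /cvF; exact: xgetPex.
exists F; split=> z zr; first by apply: FP; rewrite /sg; lra.
have zs : normc z <= sg by rewrite /sg; lra.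
have [G hG] := cvG _ zs.
pose K := 2 * B * sg ^- 2.
have K0 : 0 <= K by rewrite !mulr_ge0// invr_ge0 exprn_ge0// ltW.
(* The inequality is summed over the terms of the partial sums and then passed to the limit; the
   geometric sum supplies the 2 in [K]. *)
have main h : normc h < r / 16 -> normc (F (z + h) - F z - h * G) <= K * normc h ^+ 2.
  move=> hr; have zhs : normc (z + h) <= sg by rewrite /sg; have := normcD z h; lra.
  pose S (u : nat -> Cplx R) N := series u N.
  have cv : S (fun k => (z + h) ^+ k * q k) N + -1 * S (fun k => z ^+ k * q k) N
      + - h * S (fun k => k%:R * z ^+ k.-1 * q k) N @[N --> \oo] -->
      (F (z + h) + -1 * F z + - h * G : Cplx R).
    apply: cvgC_add; first apply: cvgC_add.
    - exact: FP.
    - by apply: cvgC_mul; [exact: cvgC_cst|exact: FP].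
    - by apply: cvgC_mul; [exact: cvgC_cst|exact: hG].
  rewrite -mulN1r -mulNr; apply: (normc_cvg_le cv); apply: nearW => N.
  rewrite /S /series/= !mulr_sumr -!big_split/=.
  apply: le_trans (normc_sum _ _ _) _.
  apply: le_trans (_ : \sum_(0 <= k < N) B * sg ^- 2 * normc h ^+ 2 * 2^-1 ^+ k <= _).
    apply: ler_sum => k _.
    have -> : (z + h) ^+ k * q k + -1 * (z ^+ k * q k) + - h * (k%:R * z ^+ k.-1 * q k) =
      ((z + h) ^+ k - z ^+ k - k%:R * h * z ^+ k.-1) * q k by ring.
    rewrite normcMl; have := expr_taylor2 k s0 zs zhs.
    move/(ler_wpM2r (normc_ge0 (q k)))/le_trans; apply.
    have -> : k%:R ^+ 2 * sg ^+ k * sg ^- 2 * normc h ^+ 2 * normc (q k) =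
      (sg ^- 2 * normc h ^+ 2) * (k%:R ^+ 2 * (sg ^+ k * normc (q k))) by ring.
    have -> : B * sg ^- 2 * normc h ^+ 2 * 2^-1 ^+ k = (sg ^- 2 * normc h ^+ 2) * (B * 2^-1 ^+ k).
      by ring.
    rewrite ler_wpM2l ?mulr_ge0 ?invr_ge0 ?exprn_ge0 ?normc_ge0 ?(ltW s0)//.
    apply: le_trans (_ : k%:R ^+ 2 * (B * 8^-1 ^+ k) <= _).
      by rewrite ler_wpM2l// sqr_ge0.
    by rewrite mulrCA ler_wpM2l.
  rewrite -mulr_sumr /K.
  have g : \sum_(0 <= k < N) (2^-1 : R) ^+ k <= 2.
    have : (2^-1 : R) != 1 by rewrite lt_eqF// invf_lt1// ltr1n.
    move=> /(geometric_seriesE 1)/(congr1 (fun f => f N)).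
    rewrite /series/=; under eq_bigr do rewrite mul1r.
    have -> : (1 - 2^-1 : R) = 2^-1 by field.
    move=> ->; rewrite invrK; have : 0 <= (2^-1 : R) ^+ N by rewrite exprn_ge0.
    lra.
  have p : 0 <= B * sg ^- 2 * normc h ^+ 2.
    by rewrite !mulr_ge0 ?invr_ge0 ?exprn_ge0 ?normc_ge0 ?(ltW s0).
  have := ler_wpM2l p g; lra.
apply/cvg_ex; exists G.
apply: (cvg_sub_normc (g := fun h : Cplx R => K * normc h)).
  apply/nbhs_ballP; exists (r / 16)%:C => /=; first by rewrite ltcR divr_gt0.
  move=> h; rewrite /ball/= sub0r normrN normc_lt => hr h0.
  have -> : h^-1 *: ((F \o shift z) (h *: 1) - F z) - G = h^-1 * (F (z + h) - F z - h * G).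
    by rewrite /= [h *: 1]mulr1 (addrC h) mulrBr mulrA mulVf// mul1r.
  have nh : 0 < normc h.
    rewrite lt_neqAle normc_ge0 andbT eq_sym; apply: contra h0 => /eqP.
    by move=> /ComplexField.Normc.eq0_normc ->.
  rewrite normcMl ComplexField.Normc.normcV ler_pdivrMl// mulrCA -expr2.
  exact: main.
rewrite -[X in _ --> X](mulr0 K); apply: cvgM; first exact: cvg_cst.
rewrite -(@ComplexField.Normc.normc0 R).
by apply: (@cvg_normc _ _ _ _ (fun h => h)); exact: nbhs_dnbhs.
Qed.
End TaylorSeries.

(** * The affine symbol *)

Section Coefficients.
Context {R : realType} {n : nat}.
Implicit Types (a : mindex n -> R) (phi : mindex n -> Cplx R) (z : 'I_n -> Cplx R).

(* Vanishing at [al = 0], so that sums over |al| > 0 become sums over all [al]. *)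
Definition pos_coef a al : Cplx R := if (0 < mdeg al)%N then (a al)%:C else 0.

Lemma is_msum_pos_coef a z v :
  is_msum (R := R) (V := (Cplx R : tvsType R[i])) (fun al => (a al)%:C * mpow z al) v ->
  sums (fun al => pos_coef a al * mpow z al) v.
Proof.
apply: cvg_eq1 => J; rewrite big_mkcond; apply: eq_bigr => al _.
by rewrite /pos_coef; case: ifP => //; rewrite mul0r.
Qed.

Definition abs_summable phi (rho : R) := exists K, summable_at phi rho K.

Lemma abs_summableD phi psi rho : abs_summable phi rho -> abs_summable psi rho ->
  abs_summable (fun al => phi al + psi al) rho.
Proof.
move=> [K [p0 pK]] [L [q0 qL]]; exists (K + L).
have r0 al : 0 <= normc (phi al + psi al) * rho ^+ mdeg al <=
    normc (phi al) * rho ^+ mdeg al + normc (psi al) * rho ^+ mdeg al.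
  have := p0 al; have := q0 al; case: (leP 0 (rho ^+ mdeg al)) => h p q.
    by rewrite mulr_ge0 ?normc_ge0//= -mulrDl ler_wpM2r// normcD.
  (* [rho] may be negative here; where its power is negative, nonnegativity of the majorant forces
     the coefficient to vanish. *)
  have h0 (u : Cplx R) : 0 <= normc u * rho ^+ mdeg al -> u = 0.
    rewrite nmulr_lge0// => u0; apply/ComplexField.Normc.eq0_normc/eqP.
    by rewrite eq_le u0 normc_ge0.
  by rewrite (h0 _ p) (h0 _ q) addr0 ComplexField.Normc.normc0 mul0r addr0 lexx.
split=> [al|J]; first by case/andP: (r0 al).
apply: le_trans (lerD (pK J) (qL J)); rewrite -big_split/=.
by apply: ler_sum => al _; case/andP: (r0 al).
Qed.

Lemma abs_summableZ (k : Cplx R) phi rho : abs_summable phi rho ->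
  abs_summable (fun al => k * phi al) rho.
Proof.
move=> [K pK]; exists (normc k * K); have [m0 mB] := majorantZ (normc_ge0 k) pK.
split=> [al|J]; first by rewrite normcMl -mulrA.
by apply: le_trans (mB J); apply: ler_sum => al _; rewrite normcMl mulrA.
Qed.

Lemma abs_summable_sum (I : Type) (r : seq I) (P : pred I) (phi : I -> mindex n -> Cplx R) rho :
  0 <= rho ->
  (forall i, P i -> abs_summable (phi i) rho) ->
  abs_summable (fun al => \sum_(i <- r | P i) phi i al) rho.
Proof.
move=> rho0 ph; elim: r => [|i r IH].
  under eq_fun do rewrite big_nil; exists 0; split=> [al|J].
    by rewrite mulr_ge0 ?normc_ge0 ?exprn_ge0.
  by rewrite big1// => al _; rewrite ComplexField.Normc.normc0 mul0r.
under eq_fun do rewrite big_cons; case: (boolP (P i)) => // Pi.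
by apply: abs_summableD => //; exact: ph.
Qed.

Lemma summable_at_le phi rho K L : K <= L -> summable_at phi rho K -> summable_at phi rho L.
Proof. by move=> KL [p0 pK]; split=> // J; exact: le_trans (pK J) KL. Qed.

Lemma normc_mpow_const (y : Cplx R) (al : mindex n) : normc (mpow (fun=> y) al) = normc y ^+ mdeg al.
Proof.
rewrite -prod_word -size_word; elim: (word al) => [|j s IH].
  by rewrite big_nil expr0 ComplexField.Normc.normc1.
by rewrite big_cons normcMl IH exprS.
Qed.

(** At [u = (rho, ..., rho)] the monomial of ['i * u] has modulus [rho ^+ mdeg al]; as every [u] is
    allowed, so is every radius. *)
Lemma abs_summable_symbol (X : set 'rV[R]_n) (a : mindex n -> 'rV[R]_n -> R) x rho :
  symbol_abs_cvg X a -> X x -> 0 <= rho -> abs_summable (pos_coef (a^~ x)) rho.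
Proof.
move=> aX Xx rho0; pose u : 'rV[R]_n := const_mx rho.
pose f al := (normc ((a al x)%:C * mpow (fun j => 'i * (u 0 j)%:C) al))%:E.
pose D := [set al : mindex n | (0 < mdeg al)%N].
have sf : esum.summable D f := aX _ Xx u.
 have fE al : D al -> f al = (normc (pos_coef (a^~ x) al) * rho ^+ mdeg al)%:E.
  rewrite /D/= => al0; rewrite /f normcMl /pos_coef al0; congr (_ * _)%:E.
  rewrite (_ : (fun j => _) = (fun=> 'i * rho%:C)); last by apply/funext => j; rewrite mxE.
  rewrite normc_mpow_const normcMl normcR (ger0_norm rho0); congr (_ ^+ _).
  by rewrite /= expr0n/= expr1n add0r sqrtr1 mul1r.
have fin := sf; rewrite summableE in fin.
exists (fine (\esum_(al in D) `|f al|)%E); split=> [al|J].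
  by rewrite mulr_ge0 ?normc_ge0 ?exprn_ge0.
rewrite -lee_fin fineK// (bigID (fun al => (0 < mdeg al)%N))/= [X in _ + X]big1 ?addr0; last first.
  by move=> al /negbTE al0; rewrite /pos_coef al0 ComplexField.Normc.normc0 mul0r.
rewrite -big_filter; set s := [seq al <- enum_fset J | (0 < mdeg al)%N].
apply: esum_ge; exists [set` s].
  by split; [exact: finite_seq|move=> al /=; rewrite mem_filter => /andP[]].
rewrite -fsbig_seq ?filter_uniq ?fset_uniq// -sumEFin big_seq [leRHS]big_seq.
apply: lee_sum => al; rewrite mem_filter => /andP[al0 _].
by rewrite -fE// lee_fin ler_norm.
Qed.

(* The coefficients [c] and [d] are recovered from the symbol at [x0] and at points
   [x0 + e *: delta_mx 0 j] of the open set [X]. *)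
Lemma abs_summable_affine (X : set 'rV[R]_n) (c : mindex n -> R) (d : mindex n -> 'rV[R]_n) rho :
  open X -> X !=set0 -> symbol_abs_cvg X (affine_coef c d) -> 0 <= rho ->
  abs_summable (pos_coef c) rho /\ forall j, abs_summable (pos_coef (fun al => d al 0 j)) rho.
Proof.
move=> oX [x0 Xx0] aX rho0.
have sx x (Xx : X x) := abs_summable_symbol aX Xx rho0.
have sd j : abs_summable (pos_coef (fun al => d al 0 j)) rho.
  have [e e0 Xe] : exists2 e : R, 0 < e & X (x0 + e *: delta_mx 0 j).
    have cX : (x0 + e *: (delta_mx 0 j : 'rV[R]_n)) @[e --> (0 : R)] --> x0.
      rewrite -[X in _ --> X]addr0 -[X in _ + X](scale0r (delta_mx 0 j : 'rV[R]_n)).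
      by apply: cvgD; [exact: cvg_cst|apply: cvgZr_tmp].
    have /nbhs_ballP[e /= e0 H] := cX _ (open_nbhs_nbhs (conj oX Xx0)).
    exists (e / 2); first by rewrite divr_gt0.
    by apply: H; rewrite /ball/= sub0r normrN gtr0_norm ?divr_gt0//; lra.
  have := abs_summableZ (e^-1%:C) (abs_summableD (sx _ Xe) (abs_summableZ (-1) (sx _ Xx0))).
  congr abs_summable; apply/funext => al; rewrite /pos_coef; case: ifP => _; last first.
    by rewrite mulr0 addr0 mulr0.
  rewrite mulN1r -raddfB -rmorphM/=; congr (_%:C); rewrite /affine_coef.
  have -> : dot (x0 + e *: delta_mx 0 j) (d al) = dot x0 (d al) + e * d al 0 j.
    rewrite /dot; under eq_bigr do rewrite !mxE mulrDl.
    rewrite big_split/=; congr (_ + _); rewrite (bigD1 j)//= !eqxx mulr1 big1 ?addr0//.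
    by move=> i /negbTE ij; rewrite ij ?andbF !mulr0 mul0r.
  by field; rewrite gt_eqF.
split=> //; have := abs_summableD (sx _ Xx0)
  (abs_summableZ (-1) (abs_summable_sum (index_enum 'I_n) (P := predT) rho0
     (fun j _ => abs_summableZ (x0 0 j)%:C (sd j)))).
congr abs_summable; apply/funext => al; rewrite /pos_coef; case: ifP => _; last first.
  by rewrite big1 ?mulr0 ?addr0// => j _; rewrite mulr0.
rewrite mulN1r; under eq_bigr do rewrite -rmorphM/=.
by rewrite -raddf_sum -raddfB/= /affine_coef /dot addrK.
Qed.
End Coefficients.

(** * Exponentials of affine functions and their space derivatives *)

Section ExpAffine.
Context {R : realType} {n : nat}.
Implicit Types (D : 'I_n -> Cplx R) (x : 'rV[R]_n).

Definition lin D x : Cplx R := \sum_j (x 0 j)%:C * D j.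

Definition expo (c0 : Cplx R) D x : Cplx R := cexp (c0 + lin D x).

Lemma lin_shift D x j (h : R) : lin D (h *: delta_mx 0 j + x) = h%:C * D j + lin D x.
Proof.
rewrite /lin; under eq_bigr do rewrite !mxE rmorphD/= mulrDl.
rewrite big_split/=; congr (_ + _).
rewrite (bigD1 j)//= !eqxx mulr1 big1 ?addr0//.
by move=> i /negbTE ij; rewrite ij ?andbF !mulr0 mul0r.
Qed.

Lemma normc_lin D x (B M : R) : 0 <= B -> (forall j, `|x 0 j| <= B) -> (forall j, normc (D j) <= M) ->
  normc (lin D x) <= n%:R * (B * M).
Proof.
move=> B0 xB DM; apply: le_trans (normc_sum _ _ _) _.
apply: le_trans (_ : \sum_(j < n) B * M <= _); last by rewrite sumr_const card_ord mulr_natl.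
by apply: ler_sum => j _; rewrite normcMl normcR ler_pM// normc_ge0.
Qed.

(** The prefactor [k] keeps the form stable: a further derivative replaces [k] by [k * D j]. *)
Lemma cvg_expo_quotient (k : Cplx R) c0 D j x :
  (h%:C)^-1 * (k * expo c0 D (h *: delta_mx 0 j + x) - k * expo c0 D x) @[h --> (0 : R)^']
    --> (k * D j * expo c0 D x : Cplx R).
Proof.
have hne : \forall h \near (0 : R)^', h%:C != 0 :> R[i].
  apply/nbhs_ballP; exists 1 => //= h _ h0.
  by rewrite (inj_eq (@complexI R) h 0).
have dE : (h%:C)^-1 * ((c0 + lin D (h *: delta_mx 0 j + x)) - (c0 + lin D x))
    @[h --> (0 : R)^'] --> (D j : Cplx R).
  apply: near_cvg_eq (cvgC_cst (D j)); apply: filterS hne => h h0.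
  by rewrite lin_shift opprD addrACA subrr add0r addrK mulrA mulVf// mul1r.
have cE : c0 + lin D (h *: delta_mx 0 j + x) @[h --> (0 : R)^'] --> (c0 + lin D x : Cplx R).
  have h0 : h%:C * D j @[h --> (0 : R)^'] --> (0 * D j : Cplx R).
    apply: cvgC_mul; last exact: cvgC_cst.
    apply/cvg_normcP => e e0; apply/nbhs_ballP; exists e => // h hb _.
    by rewrite subr0 normcR; move: hb; rewrite /ball/= sub0r normrN.
  have -> : c0 + lin D x = c0 + lin D x + 0 * D j by rewrite mul0r addr0.
  by apply: cvg_eq1 (cvgC_add (cvgC_cst (c0 + lin D x)) h0) => h; rewrite lin_shift; ring.
rewrite -mulrA.
by apply: cvg_eq1 (cvgC_mul (cvgC_cst k) (cvg_cexp_quotient cE dE)) => h; rewrite /expo; ring.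
Qed.

Lemma derivable_ReIm (f : 'rV[R]_n -> Cplx R) (x e : 'rV[R]_n) (l : Cplx R) :
  (h%:C)^-1 * (f (h *: e + x) - f x) @[h --> (0 : R)^'] --> l ->
  [/\ derivable (fun y => complex.Re (f y) : R^o) x e,
      derivable (fun y => complex.Im (f y) : R^o) x e,
      'D_e (fun y => complex.Re (f y) : R^o) x = complex.Re l &
      'D_e (fun y => complex.Im (f y) : R^o) x = complex.Im l].
Proof.
move=> fl.
have reE : h^-1 *: (complex.Re (f (h *: e + x)) - complex.Re (f x) : R^o)
    @[h --> (0 : R)^'] --> (complex.Re l : R^o).
  apply: cvg_eq1 (cvg_Re fl) => h; rewrite -raddfB -fmorphV/=.
  by case: (f _ - f x) => a b /=; rewrite mul0r subr0.
have imE : h^-1 *: (complex.Im (f (h *: e + x)) - complex.Im (f x) : R^o)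
    @[h --> (0 : R)^'] --> (complex.Im l : R^o).
  apply: cvg_eq1 (cvg_Im fl) => h; rewrite -raddfB -fmorphV/=.
  by case: (f _ - f x) => a b /=; rewrite mul0r addr0.
split; [exact: cvgP reE|exact: cvgP imE|exact: cvg_lim reE|exact: cvg_lim imE].
Qed.

Lemma pderiv_expo (k : Cplx R) c0 D j :
  pderiv j (fun x => k * expo c0 D x) = (fun x => k * D j * expo c0 D x).
Proof.
apply/funext => x; rewrite /pderiv.
have [_ _ -> ->] := derivable_ReIm (f := fun x => k * expo c0 D x) (@cvg_expo_quotient k c0 D j x).
by case: (k * D j * _).
Qed.

Lemma foldr_pderiv_expo c0 D (w : seq 'I_n) :
  foldr (@pderiv R n) (expo c0 D) w = (fun x => \prod_(j <- w) D j * expo c0 D x).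
Proof.
elim: w => [|j w IH] /=; first by apply/funext => x; rewrite big_nil mul1r.
by rewrite IH pderiv_expo; apply/funext => x; rewrite big_cons; ring.
Qed.

Lemma mderiv_expo c0 D al : mderiv al (expo c0 D) = (fun x => mpow D al * expo c0 D x).
Proof. by rewrite /mderiv foldr_word foldr_pderiv_expo prod_word. Qed.

Lemma cvg_expo (T : Type) (F : set_system T) {FF : Filter F} (f : T -> 'rV[R]_n) c0 D x :
  (forall j, f t 0 j @[t --> F] --> x 0 j) -> expo c0 D (f t) @[t --> F] --> (expo c0 D x : Cplx R).
Proof.
move=> fx.
have cl : lin D (f t) @[t --> F] --> (lin D x : Cplx R).
  rewrite /lin; apply: cvg_big => [|j _]; first exact: add_continuous.
  apply: cvgC_mul; last exact: cvgC_cst.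
  apply/cvg_normcP => e e0; have /cvgrPdist_lt/(_ _ e0) := fx j.
  by apply: filterS => y; rewrite -raddfB normcR distrC.
have cE : c0 + lin D (f t) @[t --> F] --> (c0 + lin D x : Cplx R).
  exact: cvgC_add (cvgC_cst c0) cl.
have k1 : 1 * ((c0 + lin D (f t)) - (c0 + lin D x)) @[t --> F] --> (0 : Cplx R).
  rewrite -(mulr0 1) -(subrr (c0 + lin D x)); apply: cvgC_mul; first exact: cvgC_cst.
  exact: cvgC_add cE (cvgC_cst (- (c0 + lin D x))).
have -> : expo c0 D x = 0 * cexp (c0 + lin D x) + expo c0 D x by rewrite mul0r add0r.
apply: cvg_eq1 (cvgC_add (cvg_cexp_quotient cE k1) (cvgC_cst (expo c0 D x))) => y.
by rewrite mul1r /expo subrK.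
Qed.

Lemma smooth_expo (X : set 'rV[R]_n) c0 D : smooth X (expo c0 D).
Proof.
move=> w /=; rewrite foldr_pderiv_expo; split.
  apply: continuous_subspaceT => x; apply: (@cvgC_mul _ _ (nbhs x) (nbhs_filter x)).
    exact: cvg_cst.
  by apply: (@cvg_expo _ (nbhs x) (nbhs_filter x) id) => j; exact: coord_continuous.
move=> j x _; have [dRe dIm _ _] := derivable_ReIm (f := fun x => \prod_(j <- w) D j * expo c0 D x)
  (@cvg_expo_quotient (\prod_(j <- w) D j) c0 D j x).
by split; [exact: dRe|exact: dIm].
Qed.
End ExpAffine.

(** * Convergence in [funC R n X] and the action of [A] on exponentials *)

Section FunC.
Context {R : realType} {n : nat} {X : set 'rV[R]_n}.

(** Uniform convergence on all of [X] implies it on compact subsets. The estimates below are uniform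
    on the bounded set [X]. *)
Lemma cvg_funC (T : Type) (F : set_system T) {FF : Filter F} (f : T -> funC R n X) (l : funC R n X) :
  (forall e : R, 0 < e -> \forall t \near F, forall x, X x -> normc (f t x - l x) < e) ->
  f t @[t --> F] --> l.
Proof.
move=> fl; apply/fam_cvgP => K [KX _] P /uniform_nbhs[E [entE EP]].
move: entE; rewrite -entourage_ballE => -[e e0 eE].
have [e' e'0 ee] : exists2 e' : R, 0 < e' & e = e'%:C.
  exists (complex.Re e); first by move: e0; rewrite /= ltcE => /andP[].
  by apply/esym/RRe_real/ger0_real/ltW.
apply: filterS (fl _ e'0) => t ft; apply: EP => x /KX Xx.
by apply: (eE (_, _)); rewrite /ball/= ee normc_lt normcB ft.
Qed.

(** Each derivative of the exponential is a scalar multiple of it, so the operator series reduces to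
    the scalar series for [g0] and the [g j]; bounds on [x] and on the exponential make the
    convergence uniform. *)
Lemma acts_expo (A : operator X) (c : mindex n -> R) (d : mindex n -> 'rV[R]_n)
    (c0 : Cplx R) (D : 'I_n -> Cplx R) (g0 : Cplx R) (g : 'I_n -> Cplx R) (B : R) :
  acts_as_series A (affine_coef c d) ->
  (forall x, X x -> forall j, `|x 0 j| <= B) -> 0 <= B ->
  sums (fun al => pos_coef c al * mpow D al) g0 ->
  (forall j, sums (fun al => pos_coef (fun al => d al 0 j) al * mpow D al) (g j)) ->
  A (expo c0 D, fun x => (g0 + lin g x) * expo c0 D x).
Proof.
move=> hA XB B0 sc sd; apply: hA; first exact: smooth_expo.
pose Q (phi : mindex n -> Cplx R) J := usum (fun al => phi al * mpow D al) J.
pose pd j al : Cplx R := pos_coef (fun al => d al 0 j) al.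
have EB : exists2 L, 0 < L & forall x, X x -> normc (expo c0 D x) <= L.
  have [M DM] : exists M, forall j, normc (D j) <= M.
    exists (\sum_j normc (D j)) => j; rewrite (bigD1 j)//= lerDl sumr_ge0// => i _.
    exact: normc_ge0.
  exists (expR (normc c0 + n%:R * (B * M))); first exact: expR_gt0.
  move=> x Xx; rewrite /expo normc_cexp ler_expR.
  apply: le_trans (ler_norm _) _; apply: le_trans (normc_Re _) _.
  apply: le_trans (normcD _ _) _; rewrite lerD2l.
  by apply: normc_lin => //; exact: XB.
have [L L0 EL] := EB.
have sumE J x : (\sum_(al <- enum_fset J | (0 < mdeg al)%N)
    (fun x : 'rV[R]_n => (affine_coef c d al x)%:C * mderiv al (expo c0 D) x)) x =
    (Q (pos_coef c) J + lin (fun j => Q (pd j) J) x) * expo c0 D x.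
  rewrite /Q /lin fct_sumE.
  under [X in _ + X]eq_bigr do rewrite mulr_sumr.
  rewrite exchange_big -big_split/= mulr_suml big_mkcond; apply: eq_bigr => al _.
  rewrite mderiv_expo /pd /pos_coef; case: ifP => al0; last first.
    by rewrite big1 => [|j _]; rewrite ?mul0r ?mulr0 ?addr0 ?mul0r.
  rewrite mulrA; congr (_ * _); rewrite /affine_coef rmorphD/= mulrDl; congr (_ + _).
  rewrite /dot raddf_sum mulr_suml; apply: eq_bigr => j _.
  by rewrite /= rmorphM mulrA.
apply: cvg_funC => e e0.
pose de := e / (2 * L * (1 + n%:R * B)).
have p0 : 0 < 1 + n%:R * B by rewrite ltr_pwDl// mulr_ge0.
have de0 : 0 < de by rewrite divr_gt0// !mulr_gt0.
have near0 : \forall J \near @totally (mindex n), normc (Q (pos_coef c) J - g0) < de.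
  by move/cvg_normcP: sc; apply.
have nearj : \forall J \near @totally (mindex n), forall j, normc (Q (pd j) J - g j) < de.
  by apply: filter_forall => j; move/cvg_normcP: (sd j); apply.
apply: filterS2 near0 nearj => J h0 hj x Xx.
rewrite sumE -mulrBl opprD addrACA normcMl.
have -> : lin (fun j => Q (pd j) J) x - lin g x = lin (fun j => Q (pd j) J - g j) x.
  by rewrite /lin -sumrB; apply: eq_bigr => j _; rewrite mulrBr.
have hl := @normc_lin _ _ (fun j => Q (pd j) J - g j) x B de B0 (XB _ Xx) (fun j => ltW (hj j)).
have h1 : normc (Q (pos_coef c) J - g0 + lin (fun j => Q (pd j) J - g j) x) <= de * (1 + n%:R * B).
  by apply: le_trans (normcD _ _) _; move: (ltW h0) hl; lra.
apply: le_lt_trans (ler_pM (normc_ge0 _) (normc_ge0 _) h1 (EL _ Xx)) _.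
have -> : de * (1 + n%:R * B) * L = e / 2 by rewrite /de; field; rewrite !gt_eqF.
by rewrite ltr_pdivrMr// ltr_pMr// ltr1n.
Qed.
End FunC.

(** * The exponential-affine solution *)

Lemma closed_cvg_pair (T : Type) (U V : topologicalType) (F : set_system T)
    {FF : ProperFilter F} (f : T -> U) (g : T -> V) (a : U) (b : V) (A : set (U * V)) :
  closed A -> f x @[x --> F] --> a -> g x @[x --> F] --> b ->
  (\forall x \near F, A (f x, g x)) -> A (a, b).
Proof.
move=> cA fa gb nA; apply: (closed_cvg A cA nA).
exact: (cvg_pair fa gb).
Qed.

Section AffineFlow.
Context {R : realType} {n : nat} {X : set 'rV[R]_n}.

(** The mean value inequality is used twice: for [g t - g s], and for [f t + (s - t) g s], whose
    derivative is that difference. Each use costs a factor 2. *)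
Lemma der_taylor2 (f g g2 : R -> Cplx R) (s h B : R) : der f g -> der g g2 ->
  0 <= s -> 0 <= s + h ->
  (forall t, 0 <= t -> `|t - s| <= `|h| -> normc (g2 t) <= B) ->
  normc (f (s + h) - f s - h%:C * g s) <= 4 * B * `|h| ^+ 2.
Proof.
move=> fg gg2 s0 sh0 g2B.
have hs (t a b : R) : Num.min a b <= t <= Num.max a b -> `|t - a| <= `|b - a|.
  case: (leP a b) => ab /andP[h1 h2]; first by rewrite !ger0_norm; lra.
  by rewrite !ler0_norm; lra.
have dphi : der (fun t => f t + (s - t)%:C * g s) (fun t => g t - g s).
  apply: der_ext (derD fg (derM (@der_sub _ s) (der_cst (g s)))) => t _ //.
  by rewrite mulr0 addr0 mulN1r.
have gle t : Num.min s (s + h) <= t <= Num.max s (s + h) -> normc (g t - g s) <= 2 * B * `|h|.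
  move=> tI; have th := hs _ _ _ tI; rewrite (addrC s) addrK in th.
  have t0 : 0 <= t by case/andP: tI => + _; apply: le_trans; rewrite le_min s0.
  have B0 : 0 <= B by apply: le_trans (g2B s s0 _); rewrite ?normc_ge0// subrr normr0.
  apply: le_trans (@der_le_norm _ _ _ s t B gg2 s0 t0 _) _ => [t' /[dup] t'I /hs t't|].
    have t'0 : 0 <= t' by case/andP: t'I => + _; apply: le_trans; rewrite le_min s0.
    by apply: g2B => //; exact: le_trans t't th.
  by rewrite ler_wpM2l// mulr_ge0.
have := @der_le_norm _ _ _ s (s + h) (2 * B * `|h|) dphi s0 sh0 gle.
have -> : f (s + h) + (s - (s + h))%:C * g s - (f s + (s - s)%:C * g s) =
    f (s + h) - f s - h%:C * g s.
  have -> : s - (s + h) = - h by ring.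
  by rewrite subrr raddfN/=; ring.
move=> /le_trans; apply; rewrite (addrC s) addrK expr2; lra.
Qed.

Lemma jnorm_lin r N (f : nat -> Cplx R) (g : 'I_n -> nat -> Cplx R) (x : 'rV[R]_n) (B K : R) :
  0 <= r -> 0 <= B ->
  (forall j, `|x 0 j| <= B) -> jnorm r N f <= K -> (forall j, jnorm r N (g j) <= K) ->
  jnorm r N (fun k => f k + lin (fun j => g j k) x) <= K + n%:R * (B * K).
Proof.
move=> r0 B0 xB fK gK.
apply: le_trans (_ : jnorm r N f + \sum_(j < n) `|x 0 j| * jnorm r N (g j) <= _).
  rewrite /jnorm; under [X in _ + X]eq_bigr do rewrite mulr_sumr.
  rewrite exchange_big -big_split/=; apply: ler_sum => k _.
  under [X in _ <= _ + X]eq_bigr do rewrite mulrA -normcR -normcMl.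
  rewrite -mulr_suml -mulrDl ler_wpM2r ?exprn_ge0//.
  by apply: le_trans (normcD _ _) _; rewrite lerD2l; exact: normc_sum.
apply: lerD => //; apply: le_trans (_ : \sum_(j < n) B * K <= _); last first.
  by rewrite sumr_const card_ord mulr_natl.
by apply: ler_sum => j _; apply: ler_pM => //; exact: jnorm_ge0.
Qed.

Context (c : mindex n -> R) (d : mindex n -> 'rV[R]_n) (u : 'rV[R]_n)
  (C : R -> Cplx R) (D : R -> 'I_n -> Cplx R) (hCD : ode_solution c d u C D)
  (B M K r : R).
Hypothesis B0 : 0 <= B.
Hypothesis XB : forall x, X x -> forall j, `|x 0 j| <= B.
Hypothesis DM : forall s j, 0 <= s -> normc (D s j) <= M.
Let phi := pos_coef c.
Let psi j := pos_coef (fun al => d al 0 j).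
Hypothesis phiK : summable_at phi (M + 1) K.
Hypothesis psiK : forall j, summable_at (psi j) (M + 1) K.
Hypothesis r0 : 0 < r.
Hypothesis rK : r * K <= 1.
Hypothesis rW : r * (K + n%:R * (B * K)) <= 1 / 2.

(* Taylor coefficients of [D] at time [s]. *)
Let jet s := flow_jet psi (D s).

(* Taylor coefficients of the derivative of [C + x^T D] at time [s]. *)
Definition symbol_jet (x : 'rV[R]_n) k s : Cplx R :=
  jseries phi (jet s) k + lin (fun j => jseries (psi j) (jet s) k) x.

(* The [k]-th Taylor coefficient at time [s] of [exp (C + x^T D)]. *)
Definition wave_jet k s (x : 'rV[R]_n) : Cplx R :=
  exp_jet ((symbol_jet x)^~ s) (expo (C s) (D s) x) k.

Lemma jet0 s : jet s 0%N = D s. Proof. by rewrite /jet flow_jetE. Qed.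

Lemma jet_norm N s j : 0 <= s -> jnorm r N (fun i => jet s i j) <= M + 1.
Proof. by move=> s0; apply: flow_jet_norm r0 rK _ psiK => i; exact: DM. Qed.

(** The jet of order 0 is the point [D s] itself, so [jseries] of order 0 is the value there of the
    power series in the ODE system. *)
Lemma sums_symbol (a : mindex n -> R) s : 0 <= s -> summable_at (pos_coef a) (M + 1) K ->
  sums (fun al => pos_coef a al * mpow (D s) al) (jseries (pos_coef a) (jet s) 0).
Proof.
move=> s0 aK; have := @jseriesP _ _ (pos_coef a) r (jet s) (M + 1) K 0 r0 aK.
move=> /(_ (fun j => jet_norm 1 j s0)); congr (sums _ _).
by apply/funext => al; rewrite jmon0 jet0.
Qed.

Lemma der_ode (a : mindex n -> R) (f : R -> Cplx R) : summable_at (pos_coef a) (M + 1) K ->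
  (forall s, 0 <= s -> exists2 v : Cplx R,
    is_msum (R := R) (V := (Cplx R : tvsType R[i])) (fun al => (a al)%:C * mpow (D s) al) v &
    is_derive_in (R := R) (V := (Cplx R : tvsType R[i])) `[0, +oo[ f s v) ->
  der f (fun s => jseries (pos_coef a) (jet s) 0).
Proof.
move=> aK fv s s0; have [v /is_msum_pos_coef av] := fv s s0.
by rewrite (sums_unique (sums_symbol s0 aK) av).
Qed.

Lemma derC : der C (fun s => jseries phi (jet s) 0).
Proof. by apply: der_ode phiK _; case: hCD. Qed.

Lemma derD_coord j : der (D^~ j) (fun s => jseries (psi j) (jet s) 0).
Proof. by apply: der_ode (psiK j) _; case: hCD => _ _ _; exact. Qed.

Lemma der_jet k j : der (fun s => jet s k j) (fun s => k.+1%:R * jet s k.+1 j).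
Proof. exact: flow_jet_der r0 rK DM psiK derD_coord k j. Qed.

Lemma der_symbol x k : der (symbol_jet x k) (fun s => k.+1%:R * symbol_jet x k.+1 s).
Proof.
have jd ph (pK : summable_at ph (M + 1) K) :=
  @jseries_der _ _ ph (fun i s => jet s i) r (M + 1) K k r0 pK
    (fun N s j s0 => jet_norm N j s0) (fun i j _ => @der_jet i j).
apply: der_ext (derD (jd _ phiK) (der_sum (r := index_enum 'I_n) (P := predT)
  (fun j _ => derZ (k := (x 0 j)%:C) (jd _ (psiK j))))) => s _ //.
rewrite /symbol_jet mulrDr; congr (_ + _); rewrite /lin mulr_sumr.
by apply: eq_bigr => j _; rewrite mulrCA.
Qed.

Lemma der_wave0 x : der (fun s => expo (C s) (D s) x)
  (fun s => symbol_jet x 0 s * expo (C s) (D s) x).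
Proof.
apply: der_cexp; apply: derD; first exact: derC.
apply: der_sum => j _; apply: derZ; exact: derD_coord.
Qed.

Lemma wave_jet0 s : wave_jet 0 s = expo (C s) (D s).
Proof. by apply/funext => x; rewrite /wave_jet exp_jetE. Qed.

Lemma wave_jet1 s x : wave_jet 1 s x = symbol_jet x 0 s * expo (C s) (D s) x.
Proof. by rewrite /wave_jet exp_jetE invr1 mul1r conv0 exp_jetE. Qed.

Lemma der_wave x k : der (fun s => wave_jet k s x) (fun s => k.+1%:R * wave_jet k.+1 s x).
Proof.
exact: (@exp_jet_der _ (symbol_jet x) (fun s => expo (C s) (D s) x) (@der_symbol x) (@der_wave0 x) k).
Qed.

(** The exponent bounds [C + x^T D] at times within 1 of [s]: by the mean value inequality [C] moves
    by at most [2 * K], and [n * B * M] bounds the linear part. The leading 2 comes from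
    [exp_jet_norm]. Since [C] is not assumed bounded, the bound depends on [s]. *)
Definition wave_bound s : R := 2 * expR (normc (C s) + 2 * K + n%:R * (B * M)).

Lemma wave_jet_le k s s' x : X x -> 0 <= s -> 0 <= s' -> `|s' - s| <= 1 ->
  normc (wave_jet k s' x) <= wave_bound s * r ^- k.
Proof.
move=> Xx s0 s'0 ss; rewrite ler_pdivlMr ?exprn_gt0//.
have W N : jnorm r N ((symbol_jet x)^~ s') <= K + n%:R * (B * K).
  apply: jnorm_lin => //; [exact: ltW|exact: XB| |].
    by apply: jnorm_jseries r0 phiK _ => j; exact: jet_norm.
  by move=> j; apply: jnorm_jseries r0 (psiK j) _ => i; exact: jet_norm.
have := @exp_jet_norm _ ((symbol_jet x)^~ s') (expo (C s') (D s') x) r _ k.+1 r0 rW W.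
move=> h; apply: le_trans (jnorm_coef _ (ltW r0) (ltnSn k)) _; apply: le_trans h _.
rewrite /wave_bound ler_wpM2l// /expo normc_cexp ler_expR.
apply: le_trans (ler_norm _) _; apply: le_trans (normc_Re _) _.
apply: le_trans (normcD _ _) _; apply: lerD; last first.
  by apply: normc_lin => //; [exact: XB|move=> j; exact: DM].
have K0 : 0 <= K by have := phiK.2 fset0; rewrite big_nil.
have CK t : 0 <= t -> normc (jseries phi (jet t) 0) <= K.
  move=> t0; have := @jnorm_jseries _ _ phi r (jet t) (M + 1) K 1 r0 phiK (fun j => jet_norm 1 j t0).
  by rewrite /jnorm big_ord1 expr0 mulr1.
have := @der_le_norm _ _ _ s s' K derC s0 s'0.
move=> h; have {}h : normc (C s' - C s) <= 2 * K * `|s' - s|.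
  by apply: h => t /andP[tm _]; apply: CK; apply: le_trans tm; rewrite le_min s0.
have := normcD (C s' - C s) (C s); rewrite subrK => h2.
have : 2 * K * `|s' - s| <= 2 * K * 1 by rewrite ler_wpM2l// mulr_ge0.
lra.
Qed.

(** The time derivative of order [k] of the exponential-affine function, which turns out to be its
    image under [A^k]. *)
Definition power_jet k s : funC R n X := k`!%:R *: (wave_jet k s : funC R n X).

Lemma power_jetE k s x : power_jet k s x = k`!%:R * wave_jet k s x.
Proof. by []. Qed.

Lemma power_jet0 s x : power_jet 0 s x = wave_jet 0 s x.
Proof. by rewrite power_jetE (_ : 0`!%:R = 1 :> Cplx R)// mul1r. Qed.

Lemma is_derive_in_power_jet k s : 0 <= s ->
  is_derive_in (R := R) (V := funC R n X) `[0, +oo[ (power_jet k) s (power_jet k.+1 s).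
Proof.
(* [b] bounds the second time derivative of [wave_jet k], uniformly on [X], at times within 1 of
   [s]; this is why [h] is kept below 1. *)
move=> s0; pose b := k.+1%:R * (k.+2%:R * (wave_bound s * r ^- k.+2)).
pose L := k`!%:R * (4 * b).
have b0 : 0 <= b by rewrite !mulr_ge0 ?expR_ge0 ?invr_ge0 ?exprn_ge0 ?(ltW r0).
have L0 : 0 <= L by apply: mulr_ge0 => //; apply: mulr_ge0.
apply: (@cvg_funC _ _ _ _ (incr s)) => e e0.
have ne : 0 < Num.min 1 (e / (L + 1)) by rewrite lt_min ltr01 divr_gt0// ltr_wpDl.
apply: filterS2 (near_incr s) (incr_small s ne) => h [h0 sh]; rewrite lt_min => /andP[h1 hL] x Xx.
have hn0 : 0 < `|h| by rewrite normr_gt0.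
have hC : h%:C != 0 :> R[i] by rewrite (inj_eq (@complexI R) h 0).
rewrite [X in normc X](_ : _ = (h%:C)^-1 *
  (power_jet k (s + h) x - power_jet k s x - h%:C * power_jet k.+1 s x)); last first.
  by rewrite mulrBr mulrA mulVf// mul1r.
rewrite !power_jetE factS natrM.
have aux (m v v' z l v1 : Cplx R) : m * v - m * v' - z * (l * m * v1) = m * (v - v' - z * (l * v1)).
  by ring.
rewrite aux {aux}.
rewrite normcMl ComplexField.Normc.normcV normcR ltr_pdivrMl// normcMl normc_nat.
have := @der_taylor2 _ _ _ s h b
  (@der_wave x k) (derZ (k := k.+1%:R) (@der_wave x k.+1)) s0 sh.
move=> H; apply: le_lt_trans (ler_wpM2l (ler0n _ _) (H _)) _ => [t t0 ts|].
  rewrite (normcMl k.+1%:R) (normcMl k.+2%:R) !normc_nat; do 2 apply: ler_wpM2l => //.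
  apply: wave_jet_le => //.
  by apply: le_trans ts _; exact: ltW.
rewrite mulrA -/L expr2 mulrA mulrC ltr_pM2l//.
apply: le_lt_trans (_ : (L + 1) * `|h| < _); first by rewrite ler_wpM2r// lerDl.
by rewrite mulrC -ltr_pdivlMr// ltr_wpDl.
Qed.

Context (A : operator X) (hA : closed_operator A).
Hypothesis hAcd : acts_as_series A (affine_coef c d).

(** Order 0 is the action on a pure exponential. Beyond it, the relation is differentiated in time,
    so the series of [A] never has to be applied to the more complicated [wave_jet k]. *)
Lemma operator_power_jet k s : 0 <= s -> A (power_jet k s, power_jet k.+1 s).
Proof.
elim: k s => [|k IH] s s0.
  have := @acts_expo _ _ _ A c d (C s) (D s) _ _ B hAcd XB B0 (sums_symbol s0 phiK) (fun j => sums_symbol s0 (psiK j)).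
  congr (A (_, _)); apply/funext => x; rewrite power_jetE ?mul1r ?wave_jet0//.
  by rewrite wave_jet1.
(* Difference quotients in time converge in both components, and [A] is closed. *)
have [_ [A0 Alin] _ cA] := hA.
have Fs := incr_proper s0.
pose v1 h : funC R n X := (h%:C)^-1 *: (power_jet k (s + h) - power_jet k s).
pose v2 h : funC R n X := (h%:C)^-1 *: (power_jet k.+1 (s + h) - power_jet k.+1 s).
have l1 : v1 h @[h --> incr s] --> power_jet k.+1 s := @is_derive_in_power_jet k s s0.
have l2 : v2 h @[h --> incr s] --> power_jet k.+2 s := @is_derive_in_power_jet k.+1 s s0.
apply: (@closed_cvg_pair _ (funC R n X) (funC R n X) (incr s) Fs v1 v2 _ _ A cA l1 l2).
apply: filterS (near_incr s) => h [h0 sh].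
(* Linearity is given in the form [z *: v + w]: the inner use with [-1] forms the difference, the
   outer one with [w = 0] scales it. *)
have := Alin (h%:C)^-1 _ _ (Alin (-1) _ _ (IH s s0) (IH _ sh)) A0.
congr A; rewrite addr0 scaleN1r; congr (_, _); rewrite /= (addrC (- _)) //.
Qed.

Lemma evolves_wave (T : R) : evolves_on A `[0, T[ (power_jet 0).
Proof.
move=> s; rewrite /= in_itv/= => /andP[s0 sT].
exists (power_jet 1 s); first exact: operator_power_jet.
have := @is_derive_in_power_jet 0 s s0; apply: cvg_trans; apply: cvg_app.
apply: within_subset.
  by move=> h; rewrite /= !in_itv/= => /andP[-> _].
Qed.

(** [op_pow] of order 0 asks for equality on [X] only, which absorbs the arbitrary values of [f]
    outside [X]. *)
Lemma op_pow_power_jet k s (f : funC R n X) : 0 <= s -> {in X, f =1 power_jet 0 s} ->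
  op_pow A k f (power_jet k s).
Proof.
move=> s0 f0; elim: k => //= k IH.
by exists (power_jet k s) => //; exact: operator_power_jet.
Qed.
End AffineFlow.

(** * Initial value, choice of constants and conclusion *)

Lemma expo_expi (R : realType) (n : nat) (u x : 'rV[R]_n) :
  expo 0 (fun j => 'i * (u 0 j)%:C) x = expi u x.
Proof.
rewrite /expo add0r; have -> : lin (fun j => 'i * (u 0 j)%:C) x = 'i * (dot u x)%:C.
  rewrite /lin /dot raddf_sum mulr_sumr; apply: eq_bigr => j _.
  by rewrite /= rmorphM mulrCA; congr (_ * _); exact: mulrC.
have -> : 'i * (dot u x)%:C = 0 +i* dot u x :> R[i].
  by apply/eqP; rewrite eq_complex/=; apply/andP; split; apply/eqP; ring.
by rewrite /cexp/= expR0 mul1r.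
Qed.

Lemma bounded_coord (R : realType) (n : nat) (X : set 'rV[R]_n) : bounded_set X ->
  exists2 B : R, 0 <= B & forall x, X x -> forall j, `|x 0 j| <= B.
Proof.
move=> /pinfty_ex_gt0[B B0 XB]; exists B; first exact: ltW.
move=> x Xx j; apply: le_trans (XB x Xx).
rewrite [leRHS]/Num.Def.normr /= mx_normrE; apply/bigmax_geP; right => /=.
by exists (0, j).
Qed.

Theorem theorem5p4 (R : realType) (n : nat) (X : set 'rV[R]_n)
    (c : mindex n -> R) (d : mindex n -> 'rV[R]_n) (A : operator X)
    (p : 'rV[R]_n -> R -> funC R n X)
    (C : 'rV[R]_n -> R -> Cplx R) (D : 'rV[R]_n -> R -> 'I_n -> Cplx R)
    (hX : bounded_domain X)
    (hA : closed_operator A)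
    (hAcd : acts_as_series A (affine_coef c d))
    (hcvg : symbol_abs_cvg X (affine_coef c d))
    (hp : forall u, unique_solution A (expi u) (p u))
    (hCD : forall u, ode_solution c d u (C u) (D u))
    (hD : forall u, exists M : R, forall s, 0 <= s -> forall j,
      `|D u s j| <= M%:C) :
  forall u : 'rV[R]_n, exists2 r : R, 0 < r &
    forall t : R, 0 <= t ->
      exists2 Ap : nat -> funC R n X,
        forall k, op_pow A k (p u t) (Ap k) &
        forall x, X x -> exists F : Cplx R -> Cplx R,
          [/\ forall z : Cplx R, `|z| < r%:C -> derivable F z 1,
              forall s : R, `|s| < r -> 0 <= t + s -> F s%:C = p u (t + s) x &
              forall z : Cplx R, `|z| < r%:C ->
                series (fun k => z ^+ k / k`!%:R * Ap k x) @ \oo --> F z].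
Proof.
move=> u; case: hX => oX _ X0 /bounded_coord[B B0 XB].
have [M [M0 DM]] : exists M : R, 0 <= M /\ forall s j, 0 <= s -> normc (D u s j) <= M.
  have [M DM] := hD u; exists `|M|; split=> // s j s0.
  by apply: le_trans (ler_norm M); rewrite -normc_le; exact: DM.
have [[K0 cK0] dK] := abs_summable_affine oX X0 hcvg (addr_ge0 M0 ler01).
have [Kd {}dK] := choice dK.
(* One constant for [c] and all coordinates of [d]; the summand 1 gives [K >= 1], hence [r <= 1]. *)
pose K := 1 + `|K0| + \sum_j `|Kd j|.
have K1 : 1 <= K by rewrite /K -addrA lerDl addr_ge0// sumr_ge0.
have cK : summable_at (pos_coef c) (M + 1) K.
  apply: summable_at_le cK0; apply: le_trans (ler_norm _) _.
  by rewrite /K addrAC lerDr addr_ge0// sumr_ge0.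
have {}dK j : summable_at (pos_coef (fun al => d al 0 j)) (M + 1) K.
  apply: summable_at_le (dK j); apply: le_trans (ler_norm _) _.
  rewrite /K (bigD1 j)//= addrCA lerDl.
  by rewrite !addr_ge0// sumr_ge0.
(* [W] bounds the jet norm of the derivative of [C + x^T D], and [r = 1 / (2 W)] is what
   [exp_jet_norm] asks for. None of these constants depends on [t]. *)
pose W := K + n%:R * (B * K).
have KW : K <= W by rewrite lerDl !mulr_ge0// (le_trans ler01).
have W0 : 0 < W by apply: lt_le_trans (le_trans K1 KW).
pose r := (2 * W)^-1.
have r0 : 0 < r by rewrite invr_gt0 mulr_gt0.
have rW : r * W = 1 / 2 by rewrite /r; field; rewrite gt_eqF.
have rK : r * K <= 1 by have := ler_wpM2l (ltW r0) KW; rewrite rW; lra.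
have r1 : r <= 1 by have := ler_wpM2l (ltW r0) K1; lra.
have rW' : r * (K + n%:R * (B * K)) <= 1 / 2 by rewrite -/W rW.
have [_ p0 pU] := hp u.
have [C0 D0 _ _] := hCD u.
pose V k s : funC R n X := power_jet c d (C u) (D u) k s.
have pV s : 0 <= s -> {in X, p u s =1 V 0%N s}.
  (* Uniqueness is used from time 0, on an interval reaching past [s]. *)
  move=> s0 x xX; apply/esym; apply: (pU 0 (s + 1) (V 0%N)) xX => //.
  - by rewrite ltr_wpDl.
  - exact: (evolves_wave (hCD u) B0 XB DM cK dK r0 rK rW' hA hAcd).
  - move=> y yX; rewrite p0//.
    rewrite /V power_jet0 wave_jet0 C0 -expo_expi.
    by have -> : D u 0 = (fun j => 'i * (u 0 j)%:C) by exact/funext.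
  - by rewrite s0 ltrDl ltr01.
(* The radius of [power_series_derivable]; it also gives [4 * |s| <= r] for the Taylor remainder and
   [|s| <= 1] for [wave_bound]. *)
exists (r / 16); first by rewrite divr_gt0.
move=> t t0; exists (V ^~ t).
  by move=> k; apply: (op_pow_power_jet (hCD u) B0 XB DM cK dK r0 rK rW' hA hAcd) => //; exact: pV.
move=> x Xx; pose q k s : Cplx R := wave_jet c d (C u) (D u) k s x.
have qb k s : 0 <= s -> `|s - t| <= 1 -> normc (q k s) <= wave_bound (n := n) (C u) B M K t * r ^- k.
  by move=> s0 st; apply: (wave_jet_le (hCD u) B0 XB DM cK dK r0 rK rW').
have qt k : normc (q k t) <= wave_bound (n := n) (C u) B M K t * r ^- k.
  by apply: qb; rewrite ?subrr ?normr0.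
have [F [FP dF]] := power_series_derivable r0 qt.
exists F; split=> [z|s sr ts0|z].
- by rewrite normc_lt; exact: dF.
- have xX : x \in X by rewrite inE.
  rewrite (pV _ ts0 x xX) /V power_jet0.
  have sr' : normc (s%:C : Cplx R) < r / 16 by rewrite normcR.
  have ets : t + s - t = s by rewrite (addrC t) addrK.
  have := @taylor_series _ q t (t + s) r (wave_bound (n := n) (C u) B M K t)
    (fun k => der_wave (hCD u) DM cK dK r0 rK (x := x) (k := k)) t0 ts0 r0.
  rewrite ets => h.
  (* [F] is the sum of the power series at [t]; for real [s] of either sign the same series
     converges to the solution by Taylor's formula, and limits are unique. *)
  suff hs : series (fun k => s%:C ^+ k * q k t) @ \oo --> q 0%N (t + s).
    exact: (@cvg_unique (Cplx R) (@norm_hausdorff _ (Cplx R)) _ _ _ _ (FP _ sr') hs).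
  apply: h; first by lra.
  move=> k s' s'I; apply: qb.
    by case/andP: s'I => + _; apply: le_trans; rewrite le_min t0.
  apply: le_trans (_ : `|s| <= 1); last by lra.
  move: s'I; case: (leP t (t + s)) => tts /andP[h1 h2].
    by rewrite !ger0_norm; lra.
  by rewrite !ler0_norm; lra.
- rewrite normc_lt => /FP.
  have -> : (fun k => z ^+ k / k`!%:R * V k t x) = (fun k => z ^+ k * q k t); last by [].
  apply/funext => k; rewrite /V power_jetE mulrA divfK//.
Qed.
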